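(* Let $p=1$, let $A_j>0$ and $B_j>0$ $(j\ge0)$ be real numbers, and let $T$, $T_{\min}=\overline{T}$, $T_{\max}=T_{\min}^*$ be the preminimal, minimal and maximal operators in $l^2$ generated by the scalar Jacobi matrix $\mathbf{J}$ with diagonal entries $A_j$ and off-diagonal entries $B_j$. Assume that $T$ is non-negative and that $T_{\min}$ has deficiency indices $n_\pm(T_{\min})=1$. Let $\Pi=\{\mathbb{C},\Gamma_0,\Gamma_1\}$ be the boundary triplet for $T_{\max}$ given by $$\Gamma_1u=\sum_{j=0}^\infty Q_j(0)(T_{\max}u)_j-u_0,\qquad \Gamma_0u=\sum_{j=0}^\infty P_j(0)(T_{\max}u)_j,\qquad u\in\operatorname{dom}(T_{\max}),$$ where $(P_j)$, $(Q_j)$ are the polynomials of the first and second kind associated with $\mathbf{J}$, and let $M(\cdot)$ be the corresponding Weyl function. Then the sequence $Q_j(0)/P_j(0)$ converges, and with $$\alpha:=\lim_{j\to\infty}\frac{Q_j(0)}{P_j(0)}$$ the set of all non-negative self-adjoint extensions $T_h$ of $T_{\min}$ is parameterized as follows: $$\operatorname{dom}(T_h)=\{u\in\operatorname{dom}(T_{\max}):\ (\Gamma_1-h\Gamma_0)u=0\},\qquad h\in[-\infty,\alpha].$$ In particular (for $h=-\infty$), $$\operatorname{dom}(T_{-\infty})=\{u\in\operatorname{dom}(T_{\max}):\ \Gamma_0u=0\}.$$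
   Context: $l^2$ is the Hilbert space of square-summable complex sequences $u=(u_j)_{j\ge0}$. With $B_{-1}:=0$, set $(\mathbf{J}u)_j=B_ju_{j+1}+A_ju_j+B_{j-1}u_{j-1}$ for $j\ge0$. The maximal operator is $T_{\max}u=\mathbf{J}u$ on $\operatorname{dom}(T_{\max})=\{u\in l^2:\mathbf{J}u\in l^2\}$. The preminimal operator $T$ is the restriction of $T_{\max}$ to finitely supported sequences, and $T_{\min}$ is the closure of $T$. One has $T_{\min}^*=T_{\max}$. The deficiency indices are $n_\pm(T_{\min})=\dim\ker(T_{\max}\pm iI)$. Each $T_h$ is the restriction of $T_{\max}$ to the indicated domain. $(P_j(z))_{j\ge0}$ is the solution of $(\mathbf{J}U)_j=zU_j$, $j\ge0$, with $P_0(z)=1$, $P_1(z)=B_0^{-1}(z-A_0)$. $(Q_j(z))_{j\ge0}$ is the solution of $(\mathbf{J}U)_j=zU_j$, $j\ge1$, with $Q_0(z)=0$, $Q_1(z)=B_0^{-1}$. Since $n_\pm(T_{\min})=1$, the sequences $(P_j(0))$ and $(Q_j(0))$ belong to $l^2$, so $\Gamma_0,\Gamma_1:\operatorname{dom}(T_{\max})\to\mathbb{C}$ are well defined. That $\{\mathbb{C},\Gamma_0,\Gamma_1\}$ is a boundary triplet for $T_{\max}$ means that $(T_{\max}f,g)-(f,T_{\max}g)=\Gamma_1f\,\overline{\Gamma_0g}-\Gamma_0f\,\overline{\Gamma_1g}$ for all $f,g\in\operatorname{dom}(T_{\max})$ and that $(\Gamma_0,\Gamma_1):\operatorname{dom}(T_{\max})\to\mathbb{C}^2$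 is surjective. The Weyl function is defined by $\Gamma_1f=M(z)\Gamma_0f$ for $f\in\ker(T_{\max}-zI)$ and $z$ in the resolvent set of $T_{\max}\upharpoonright\ker\Gamma_0$.
   Formalization: Convergence of Q_j(0)/P_j(0) is taken in [-∞,+∞): α may be -∞. A finite limit fails, e.g., when the spectrum of the Friedrichs extension of T_min starts at 0; then α=-∞ and T_{-∞} is the only non-negative self-adjoint extension. *)

(* Defs.v *)
From Stdlib Require Import Reals Lra Lia.
From Coquelicot Require Import Coquelicot.

Local Open Scope C_scope.

Definition cseq := nat -> C.

Definition in_l2 (u : cseq) : Prop := ex_series (fun j => (Cmod (u j) ^ 2)%R).

Definition l2norm (u : cseq) : R := sqrt (Series (fun j => (Cmod (u j) ^ 2)%R)).

(** Total: meaningful only when the real and imaginary parts are summable,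
    which is automatic for products of two members of l^2. *)
Definition CSeries (a : cseq) : C :=
  (Series (fun j => Re (a j)), Series (fun j => Im (a j))).

(** Linear in the first argument. *)
Definition ip (u v : cseq) : C := CSeries (fun j => u j * Cconj (v j)).

Definition seq_sub (u v : cseq) : cseq := fun j => u j - v j.

(** Operators in l^2 are represented by their graphs: [S u v] says that
    [u] is in the domain of [S] and that [S] maps [u] to [v]. *)

Definition graph := cseq -> cseq -> Prop.

Definition dom (S : graph) (u : cseq) : Prop := exists v, S u v.

Definition same_graph (S1 S2 : graph) : Prop := forall u v, S1 u v <-> S2 u v.

Definition extends (S1 S2 : graph) : Prop := forall u v, S2 u v -> S1 u v.

Definition linear_operator (S : graph) : Prop :=
  (forall u v, S u v -> in_l2 u /\ in_l2 v) /\
  (exists u, dom S u) /\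
  (forall (a b : C) u v u' v', S u v -> S u' v' ->
     S (fun j => a * u j + b * u' j) (fun j => a * v j + b * v' j)) /\
  (forall u v v', S u v -> S u v' -> forall j, v j = v' j).

Definition densely_defined (S : graph) : Prop :=
  forall u, in_l2 u -> forall eps : R, (0 < eps)%R ->
    exists w, dom S w /\ (l2norm (seq_sub u w) < eps)%R.

Definition closure (S : graph) : graph := fun u v =>
  in_l2 u /\ in_l2 v /\
  exists un vn : nat -> cseq,
    (forall n, S (un n) (vn n)) /\
    is_lim_seq (fun n => l2norm (seq_sub (un n) u)) 0%R /\
    is_lim_seq (fun n => l2norm (seq_sub (vn n) v)) 0%R.

Definition adjoint (S : graph) : graph := fun f g =>
  in_l2 f /\ in_l2 g /\ forall u v, S u v -> ip v f = ip u g.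

Definition self_adjoint (S : graph) : Prop :=
  linear_operator S /\ densely_defined S /\ same_graph S (adjoint S).

Definition nonneg_operator (S : graph) : Prop :=
  forall u v, S u v -> Im (ip v u) = 0%R /\ (0 <= Re (ip v u))%R.

(** [ker_shift S z] is ker (S + z I). *)
Definition ker_shift (S : graph) (z : C) (f : cseq) : Prop :=
  S f (fun j => - (z * f j)).

Fixpoint lincomb (n : nat) (c : nat -> C) (e : nat -> cseq) (j : nat) : C :=
  match n with
  | O => 0
  | S m => lincomb m c e j + c m * e m j
  end.

Definition has_dim (n : nat) (V : cseq -> Prop) : Prop :=
  exists e : nat -> cseq,
    (forall k, (k < n)%nat -> V (e k)) /\
    (forall c, (forall j, lincomb n c e j = 0) ->
       forall k, (k < n)%nat -> c k = 0) /\
    (forall f, V f -> exists c, forall j, f j = lincomb n c e j).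

Definition boundary_triplet (S : graph) (G0 G1 : cseq -> C) : Prop :=
  (forall f f' g g', S f f' -> S g g' ->
     ip f' g - ip f g' = G1 f * Cconj (G0 g) - G0 f * Cconj (G1 g)) /\
  (forall a b : C, exists f, dom S f /\ G0 f = a /\ G1 f = b).

Definition jacobi (A B : nat -> R) (u : cseq) : cseq := fun j =>
  RtoC (B j) * u (S j) + RtoC (A j) * u j +
  match j with O => 0 | S k => RtoC (B k) * u k end.

Definition Tpremin (A B : nat -> R) : graph := fun u v =>
  (exists N : nat, forall j, (N <= j)%nat -> u j = 0) /\
  (forall j, v j = jacobi A B u j).

Definition Tmin (A B : nat -> R) : graph := closure (Tpremin A B).

Definition Tmax (A B : nat -> R) : graph := fun u v =>
  in_l2 u /\ in_l2 v /\ (forall j, v j = jacobi A B u j).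

Definition deficiency_indices (A B : nat -> R) (n_plus n_minus : nat) : Prop :=
  has_dim n_plus (ker_shift (Tmax A B) Ci) /\
  has_dim n_minus (ker_shift (Tmax A B) (- Ci)).

(** The solution of the three-term recurrence at the spectral parameter [z]
    with initial values [a], [b]. *)
Fixpoint jsol (A B : nat -> R) (z a b : C) (j : nat) {struct j} : C :=
  match j with
  | O => a
  | S k =>
      match k with
      | O => b
      | S l => ((z - RtoC (A k)) * jsol A B z a b k
                - RtoC (B l) * jsol A B z a b l) / RtoC (B k)
      end
  end.

Definition polyP (A B : nat -> R) (z : C) : cseq :=
  jsol A B z 1 ((z - RtoC (A 0%nat)) / RtoC (B 0%nat)).

Definition polyQ (A B : nat -> R) (z : C) : cseq :=
  jsol A B z 0 (/ RtoC (B 0%nat)).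

Definition Gamma1 (A B : nat -> R) (u : cseq) : C :=
  CSeries (fun j => polyQ A B 0 j * jacobi A B u j) - u 0%nat.

Definition Gamma0 (A B : nat -> R) (u : cseq) : C :=
  CSeries (fun j => polyP A B 0 j * jacobi A B u j).

(** The restriction of Tmax to Gamma1 u = h Gamma0 u. The parameter -oo stands
    for the condition Gamma0 u = 0; so would +oo, which describes the same
    extension and lies in no interval [-oo, alpha] with alpha < +oo. *)
Definition Text (A B : nat -> R) (h : Rbar) : graph := fun u v =>
  Tmax A B u v /\
  match h with
  | Finite r => Gamma1 A B u - RtoC r * Gamma0 A B u = 0
  | _ => Gamma0 A B u = 0
  end.

Definition nonneg_sa_extension (A B : nat -> R) (S : graph) : Prop :=
  self_adjoint S /\ extends S (Tmin A B) /\ nonneg_operator S.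

(** The quotient Q_j(0)/P_j(0), which is real: see [ratioQP_real]. *)
Definition ratioQP (A B : nat -> R) (j : nat) : R :=
  Re (polyQ A B 0 j / polyP A B 0 j).

Lemma jsol_jacobi (A B : nat -> R) (HB : forall j, (0 < B j)%R) (z a b : C) :
  forall j, (1 <= j)%nat ->
  jacobi A B (jsol A B z a b) j = z * jsol A B z a b j.
Proof.
intros [|k] Hj; [lia|].
assert (H : RtoC (B (S k)) <> 0).
{ intro E. apply RtoC_inj in E. specialize (HB (S k)). lra. }
unfold jacobi. cbn [jsol]. field. exact H.
Qed.

Lemma polyP_jacobi (A B : nat -> R) (HB : forall j, (0 < B j)%R) (z : C) :
  forall j, jacobi A B (polyP A B z) j = z * polyP A B z j.
Proof.
intros [|k].
- assert (H : RtoC (B 0%nat) <> 0).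
  { intro E. apply RtoC_inj in E. specialize (HB 0%nat). lra. }
  unfold jacobi, polyP. cbn [jsol]. field. exact H.
- apply jsol_jacobi; [exact HB|lia].
Qed.

Lemma jsol_real (A B : nat -> R) (HB : forall j, (0 < B j)%R) (x a b : R) :
  forall j, exists r : R, jsol A B (RtoC x) (RtoC a) (RtoC b) j = RtoC r.
Proof.
assert (H : forall j,
  (exists r : R, jsol A B (RtoC x) (RtoC a) (RtoC b) j = RtoC r) /\
  (exists r : R, jsol A B (RtoC x) (RtoC a) (RtoC b) (S j) = RtoC r)).
{ induction j as [|j [[r Hr] [s Hs]]].
  - split; [exists a | exists b]; reflexivity.
  - split; [exists s; exact Hs|].
    exists (((x - A (S j)) * s - B j * r) / B (S j))%R.
    change (jsol A B (RtoC x) (RtoC a) (RtoC b) (S (S j))) with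
      (((RtoC x - RtoC (A (S j))) * jsol A B (RtoC x) (RtoC a) (RtoC b) (S j)
        - RtoC (B j) * jsol A B (RtoC x) (RtoC a) (RtoC b) j)
       / RtoC (B (S j))).
    rewrite Hr, Hs, RtoC_div, RtoC_minus, !RtoC_mult, RtoC_minus;
      [reflexivity | specialize (HB (S j)); lra ..]. }
intro j. apply (H j).
Qed.

Lemma ratioQP_real (A B : nat -> R) (HB : forall j, (0 < B j)%R) (j : nat) :
  polyP A B 0 j <> 0 ->
  polyQ A B 0 j / polyP A B 0 j = RtoC (ratioQP A B j).
Proof.
intro HP.
assert (H0 : B 0%nat <> 0%R) by (specialize (HB 0%nat); lra).
destruct (jsol_real A B HB 0 1 ((0 - A 0%nat) / B 0%nat)%R j) as [p Hp].
destruct (jsol_real A B HB 0 0 (/ B 0%nat)%R j) as [q Hq].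
assert (Ep : polyP A B 0 j = RtoC p).
{ unfold polyP. rewrite <- Hp, RtoC_div, RtoC_minus; [reflexivity|exact H0]. }
assert (Eq : polyQ A B 0 j = RtoC q).
{ unfold polyQ. rewrite <- Hq, RtoC_inv; [reflexivity|exact H0]. }
unfold ratioQP. rewrite Ep, Eq in *.
assert (p <> 0%R) by (intro E; apply HP; rewrite E; reflexivity).
rewrite <- RtoC_div by assumption. reflexivity.
Qed.

(* Main.v *)
Require Import Defs.
From Stdlib Require Import Reals Lra Lia.
From Stdlib Require Import FunctionalExtensionality PropExtensionality Classical.
From Coquelicot Require Import Coquelicot.

(** Write W_n(u,v) = B_n (u_n v_{n+1} - u_{n+1} v_n) and P, Q for the two kinds
    of polynomials at 0. A square-summable eigenvector at -i gives, through the
    Weyl discs, that all solutions at -i are square-summable, and variation of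
    constants transports this to 0. By Lagrange's identity Gamma_0 u and Gamma_1 u
    are the limits of W_n(P,u) and W_n(Q,u), and Green's formula is Pluecker's
    relation for Wronskians, since W(P,Q) = 1. A self-adjoint extension is then a
    real line in the boundary space.

    Non-negativity makes P_j alternate in sign, so r_j = Q_j / P_j decreases
    strictly from 0. With d_j = W_j(P,u) and e_j = W_j(Q,u), Abel summation gives
    sum_{j<=n} (Ju)_j conj(u_j) =
      sum_{j<=n} |d_j|^2 (r_j - r_{j+1}) + |d_n|^2 r_{n+1} - d_n conj(e_n),
    whose limit on the domain of T_h is at least (alpha - h) |Gamma_0 u|^2. If
    h > alpha, choose n with r_n < h: gluing (r_n - h) P to Q - h P at n yields an
    element of dom T_h whose form has the value r_n - h < 0. *)

Local Open Scope C_scope.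

(** * Complex conjugation and cancellation *)

Lemma Cconj_RtoC (x : R) : Cconj (RtoC x) = RtoC x.
Proof. unfold Cconj, RtoC; simpl; f_equal; ring. Qed.

Lemma Cconj_Ci : Cconj Ci = - Ci.
Proof. unfold Cconj, Ci, Copp; simpl; f_equal; ring. Qed.

Lemma RtoC_neq_0 (x : R) : x <> 0%R -> RtoC x <> 0.
Proof. intros H E. apply H, RtoC_inj, E. Qed.

Lemma Cmult_cancel_0 (a b : C) : a <> 0 -> a * b = 0 -> b = 0.
Proof.
intros Ha H. replace b with (/ a * (a * b)) by (field; exact Ha).
rewrite H. ring.
Qed.

Ltac conj_push :=
  repeat first [rewrite Cplus_conj | rewrite Cminus_conj | rewrite Cmult_conj
    | rewrite Copp_conj | rewrite Cconj_conj | rewrite Cconj_RtoC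
    | rewrite Cconj_Ci].

(** * Finite sums, limits and series of complex numbers *)

Definition csum (a : nat -> C) (n : nat) : C := sum_n a n.

Lemma csum_O (a : nat -> C) : csum a 0 = a 0%nat.
Proof. apply sum_O. Qed.

Lemma csum_S (a : nat -> C) (n : nat) : csum a (S n) = csum a n + a (S n).
Proof. apply (sum_Sn a). Qed.

Lemma csum_ext (a b : nat -> C) (n : nat) :
  (forall j, a j = b j) -> csum a n = csum b n.
Proof. intro H. apply sum_n_ext, H. Qed.

Lemma sum_n_S (a : nat -> R) (n : nat) : sum_n a (S n) = (sum_n a n + a (S n))%R.
Proof. apply (sum_Sn a). Qed.

Lemma csum_Re (a : nat -> C) (n : nat) :
  Re (csum a n) = sum_n (fun j => Re (a j)) n.
Proof.
induction n as [|n IH]; [now rewrite csum_O, sum_O|].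
now rewrite csum_S, sum_n_S, <- IH.
Qed.

Lemma csum_Im (a : nat -> C) (n : nat) :
  Im (csum a n) = sum_n (fun j => Im (a j)) n.
Proof.
induction n as [|n IH]; [now rewrite csum_O, sum_O|].
now rewrite csum_S, sum_n_S, <- IH.
Qed.

Lemma csum_RtoC (a : nat -> R) (n : nat) :
  csum (fun j => RtoC (a j)) n = RtoC (sum_n a n).
Proof.
induction n as [|n IH]; [now rewrite csum_O, sum_O|].
now rewrite csum_S, sum_n_S, IH, RtoC_plus.
Qed.

Lemma csum_first (a : nat -> C) (n : nat) :
  (forall j, (j < n)%nat -> a j = 0) -> csum a n = a n.
Proof.
intro H.
assert (H' : forall m, (m < n)%nat -> csum a m = 0).
{ induction m as [|m IH]; intro Hm; [rewrite csum_O; apply H; lia|].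
  rewrite csum_S, IH, H by lia. ring. }
destruct n as [|n]; [apply csum_O|].
rewrite csum_S, H' by lia. ring.
Qed.

Lemma csum_tail (a : nat -> C) (n m : nat) :
  (forall j, (n < j)%nat -> a j = 0) -> (n <= m)%nat -> csum a m = csum a n.
Proof.
intros H Hm. induction Hm as [|m Hm IH]; [reflexivity|].
rewrite csum_S, IH, H by lia. ring.
Qed.

(** Componentwise, to match [CSeries], which sums real and imaginary parts separately; real limit
    theorems then apply to each part. *)
Definition is_clim (a : nat -> C) (l : C) : Prop :=
  is_lim_seq (fun n => Re (a n)) (Re l) /\
  is_lim_seq (fun n => Im (a n)) (Im l).

Lemma is_clim_ext (a b : nat -> C) (l : C) :
  (forall n, a n = b n) -> is_clim a l -> is_clim b l.
Proof.
intros H [H1 H2]. split.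
- apply is_lim_seq_ext with (2 := H1). intro n. now rewrite H.
- apply is_lim_seq_ext with (2 := H2). intro n. now rewrite H.
Qed.

Lemma is_clim_const (a : C) : is_clim (fun _ => a) a.
Proof. split; apply is_lim_seq_const. Qed.

Lemma is_clim_eventually_const (a : nat -> C) (l : C) (N : nat) :
  (forall n, (N <= n)%nat -> a n = l) -> is_clim a l.
Proof.
intro H. split; (eapply is_lim_seq_ext_loc; [|apply is_lim_seq_const]);
  exists N; intros n Hn; now rewrite H.
Qed.

Lemma is_clim_unique (a : nat -> C) (l m : C) :
  is_clim a l -> is_clim a m -> l = m.
Proof.
intros [H1 H2] [H3 H4].
apply is_lim_seq_unique in H1, H2, H3, H4.
destruct l as [x y], m as [x' y']. unfold Re, Im in *; simpl in *.
rewrite H1 in H3. rewrite H2 in H4. injection H3. injection H4. congruence.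
Qed.

Lemma is_clim_plus (a b : nat -> C) (l m : C) :
  is_clim a l -> is_clim b m -> is_clim (fun n => a n + b n) (l + m).
Proof. intros [H1 H2] [H3 H4]. split; now apply is_lim_seq_plus'. Qed.

Lemma is_clim_opp (a : nat -> C) (l : C) :
  is_clim a l -> is_clim (fun n => - a n) (- l).
Proof. intros [H1 H2]. split; now apply is_lim_seq_opp in H1, H2. Qed.

Lemma is_clim_minus (a b : nat -> C) (l m : C) :
  is_clim a l -> is_clim b m -> is_clim (fun n => a n - b n) (l - m).
Proof. intros H1 H2. apply is_clim_plus; [|apply is_clim_opp]; assumption. Qed.

Lemma is_clim_mult (a b : nat -> C) (l m : C) :
  is_clim a l -> is_clim b m -> is_clim (fun n => a n * b n) (l * m).
Proof.
intros [H1 H2] [H3 H4]. split.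
- apply is_lim_seq_minus'; now apply is_lim_seq_mult'.
- apply is_lim_seq_plus'; now apply is_lim_seq_mult'.
Qed.

Lemma is_clim_conj (a : nat -> C) (l : C) :
  is_clim a l -> is_clim (fun n => Cconj (a n)) (Cconj l).
Proof. intros [H1 H2]. split; [exact H1|now apply is_lim_seq_opp in H2]. Qed.

Lemma is_clim_Cmod2 (a : nat -> C) (l : C) :
  is_clim a l -> is_lim_seq (fun n => (Cmod (a n) ^ 2)%R) (Cmod l ^ 2)%R.
Proof.
intros [H1 H2].
apply is_lim_seq_ext with (fun n => (Re (a n) * Re (a n) + Im (a n) * Im (a n))%R).
{ intro n. rewrite Cmod2_alt. ring. }
rewrite Cmod2_alt.
replace (Re l ^ 2 + Im l ^ 2)%R with (Re l * Re l + Im l * Im l)%R by ring.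
apply is_lim_seq_plus'; now apply is_lim_seq_mult'.
Qed.

Lemma is_series_lim_seq (a : nat -> R) (l : R) :
  is_series a l <-> is_lim_seq (sum_n a) l.
Proof. reflexivity. Qed.

Lemma CSeries_unique (a : nat -> C) (l : C) :
  is_clim (csum a) l -> CSeries a = l.
Proof.
intros [H1 H2].
rewrite (surjective_pairing l). unfold CSeries. f_equal; apply is_series_unique, is_series_lim_seq.
- apply is_lim_seq_ext with (2 := H1). intro n. apply csum_Re.
- apply is_lim_seq_ext with (2 := H2). intro n. apply csum_Im.
Qed.

Lemma ex_series_Rabs_le (a b : nat -> R) :
  (forall n, (Rabs (a n) <= b n)%R) -> ex_series b -> ex_series a.
Proof. intros H Hb. exact (ex_series_le (V := R_CompleteNormedModule) a b H Hb). Qed.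

Lemma im_le_Cmod (c : C) : (Rabs (Im c) <= Cmod c)%R.
Proof. eapply Rle_trans; [apply Rmax_r|apply (Rmax_Cmod c)]. Qed.

Lemma CSeries_correct (a : nat -> C) :
  ex_series (fun j => Cmod (a j)) -> is_clim (csum a) (CSeries a).
Proof.
intro H.
assert (H1 : ex_series (fun j => Re (a j))).
{ apply (ex_series_Rabs_le _ (fun j => Cmod (a j))); [|exact H].
  intro n. apply re_le_Cmod. }
assert (H2 : ex_series (fun j => Im (a j))).
{ apply (ex_series_Rabs_le _ (fun j => Cmod (a j))); [|exact H].
  intro n. apply im_le_Cmod. }
apply Series_correct in H1, H2. split.
- apply is_lim_seq_ext with (2 := H1). intro n. symmetry. apply csum_Re.
- apply is_lim_seq_ext with (2 := H2). intro n. symmetry. apply csum_Im.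
Qed.

Lemma CSeries_ext (a b : nat -> C) :
  (forall j, a j = b j) -> CSeries a = CSeries b.
Proof.
intro H. unfold CSeries. f_equal; apply Series_ext; intro n; now rewrite H.
Qed.

(** The partial sums are constant from index n on, so no summability has to be assumed. This
    evaluates every pairing below in which one factor is supported at a single index. *)
Lemma CSeries_single (a : nat -> C) (n : nat) :
  (forall j, j <> n -> a j = 0) -> CSeries a = a n.
Proof.
intro H. apply CSeries_unique, (is_clim_eventually_const _ _ n).
intros m Hm. rewrite (csum_tail a n); [|intros; apply H; lia|exact Hm].
apply csum_first. intros j Hj. apply H. lia.
Qed.

Lemma ex_series_bounded (a : nat -> R) (M : R) :
  (forall n, (0 <= a n)%R) -> (forall n, (sum_n a n <= M)%R) -> ex_series a.
Proof.
intros Ha HM.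
destruct (ex_finite_lim_seq_incr (sum_n a) M) as [l Hl]; [|exact HM|].
- intro n. rewrite sum_n_S. specialize (Ha (S n)). lra.
- exists l. exact Hl.
Qed.

Lemma sum_n_zero (a : nat -> R) (n : nat) :
  (forall j, (j <= n)%nat -> a j = 0%R) -> sum_n a n = 0%R.
Proof.
intro H. induction n as [|n IH]; [rewrite sum_O; apply H; lia|].
rewrite sum_n_S, IH, H by auto. apply Rplus_0_r.
Qed.

Lemma is_series_zero (a : nat -> R) : (forall j, a j = 0%R) -> is_series a 0%R.
Proof.
intro H. apply is_series_lim_seq. eapply is_lim_seq_ext; [|apply is_lim_seq_const].
intro n. symmetry. apply sum_n_zero. auto.
Qed.

Lemma sum_n_nonneg (a : nat -> R) (n : nat) :
  (forall j, (0 <= a j)%R) -> (0 <= sum_n a n)%R.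
Proof.
intro H. induction n as [|n IH]; [rewrite sum_O; apply H|].
rewrite sum_n_S. specialize (H (S n)). lra.
Qed.

Lemma sum_n_ge_term (a : nat -> R) (k n : nat) :
  (forall j, (0 <= a j)%R) -> (k <= n)%nat -> (a k <= sum_n a n)%R.
Proof.
intros H Hk. induction Hk as [|n Hk IH].
- destruct k as [|k]; [rewrite sum_O; lra|].
  rewrite sum_n_S. pose proof (sum_n_nonneg a k H). lra.
- rewrite sum_n_S. specialize (H (S n)). lra.
Qed.

Lemma sum_n_le_Series (a : nat -> R) (n : nat) :
  (forall j, (0 <= a j)%R) -> ex_series a -> (sum_n a n <= Series a)%R.
Proof.
intros H Ha. apply Series_correct in Ha.
apply (is_lim_seq_incr_compare (sum_n a)); [exact Ha|].
intro m. rewrite sum_n_S. specialize (H (S m)). lra.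
Qed.

Lemma Series_ge_term (a : nat -> R) (k : nat) :
  (forall j, (0 <= a j)%R) -> ex_series a -> (a k <= Series a)%R.
Proof.
intros H Ha. eapply Rle_trans; [|apply (sum_n_le_Series a k H Ha)].
now apply sum_n_ge_term.
Qed.

Lemma ex_series_le_R (a b : nat -> R) :
  (forall n, (0 <= a n <= b n)%R) -> ex_series b -> ex_series a.
Proof.
intros H Hb. apply (ex_series_Rabs_le a b); [|exact Hb].
intro n. rewrite Rabs_pos_eq; apply H.
Qed.

Lemma ex_series_eventually (a b : nat -> R) (N : nat) :
  (forall n, (N <= n)%nat -> a n = b n) -> ex_series b -> ex_series a.
Proof.
intros H Hb. apply (ex_series_incr_n a N).
apply (ex_series_incr_n b N) in Hb.
eapply ex_series_ext; [|exact Hb]. intro n. simpl. symmetry. apply H. lia.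
Qed.

(** * Square-summable sequences *)

Lemma in_l2_ext (u v : cseq) : (forall j, u j = v j) -> in_l2 u -> in_l2 v.
Proof. intros H. apply ex_series_ext. intro n. now rewrite H. Qed.

Lemma in_l2_bound (u : cseq) (s : nat -> R) :
  (forall j, (Cmod (u j) ^ 2 <= s j)%R) -> ex_series s -> in_l2 u.
Proof.
intros H Hs. apply (ex_series_le_R _ s); [|exact Hs].
intro n. split; [apply pow2_ge_0|apply H].
Qed.

Lemma in_l2_eventually (u v : cseq) (N : nat) :
  (forall j, (N <= j)%nat -> u j = v j) -> in_l2 v -> in_l2 u.
Proof.
intros H. apply (ex_series_eventually _ _ N). intros n Hn. now rewrite H.
Qed.

Lemma in_l2_finite (u : cseq) (N : nat) :
  (forall j, (N <= j)%nat -> u j = 0) -> in_l2 u.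
Proof.
intro H. apply (in_l2_eventually u (fun _ => 0) N); [exact H|].
exists 0%R. apply is_series_zero. intro n. rewrite Cmod_0. ring.
Qed.

Lemma Cmod_plus_sq (x y : C) : (Cmod (x + y) ^ 2 <= 2 * Cmod x ^ 2 + 2 * Cmod y ^ 2)%R.
Proof.
rewrite !Cmod2_alt. unfold Re, Im; simpl.
pose proof (pow2_ge_0 (fst x - fst y)). pose proof (pow2_ge_0 (snd x - snd y)). nra.
Qed.

Lemma in_l2_lincomb (a b : C) (u v : cseq) :
  in_l2 u -> in_l2 v -> in_l2 (fun j => a * u j + b * v j).
Proof.
intros Hu Hv.
apply (in_l2_bound _ (fun j => plus (scal (2 * Cmod a ^ 2)%R (Cmod (u j) ^ 2)%R)
  (scal (2 * Cmod b ^ 2)%R (Cmod (v j) ^ 2)%R))).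
- intro j. unfold plus, scal; simpl. unfold mult; simpl.
  eapply Rle_trans; [apply Cmod_plus_sq|]. rewrite !Cmod_mult.
  right. ring.
- apply (ex_series_plus (V := R_NormedModule)); apply (ex_series_scal_l (V := R_NormedModule)); assumption.
Qed.

Lemma in_l2_conj (u : cseq) : in_l2 u -> in_l2 (fun j => Cconj (u j)).
Proof. apply ex_series_ext. intro n. now rewrite Cmod_conj. Qed.

Lemma in_l2_mult (u v : cseq) :
  in_l2 u -> in_l2 v -> ex_series (fun j => Cmod (u j * v j)).
Proof.
intros Hu Hv.
apply (ex_series_le_R _ (fun j => plus (Cmod (u j) ^ 2)%R (Cmod (v j) ^ 2)%R)).
- intro j. split; [apply Cmod_ge_0|]. rewrite Cmod_mult. unfold plus; simpl.
  pose proof (Cmod_ge_0 (u j)). pose proof (Cmod_ge_0 (v j)). nra.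
- now apply (ex_series_plus (V := R_NormedModule)).
Qed.

Lemma CSeries_l2 (u v : cseq) : in_l2 u -> in_l2 v ->
  is_clim (csum (fun j => u j * v j)) (CSeries (fun j => u j * v j)).
Proof. intros Hu Hv. now apply CSeries_correct, in_l2_mult. Qed.

Lemma ip_correct (u v : cseq) : in_l2 u -> in_l2 v ->
  is_clim (csum (fun j => u j * Cconj (v j))) (ip u v).
Proof. intros Hu Hv. now apply CSeries_l2, in_l2_conj. Qed.

Lemma ip_conj (u v : cseq) : in_l2 u -> in_l2 v -> ip u v = Cconj (ip v u).
Proof.
intros Hu Hv. apply CSeries_unique.
eapply is_clim_ext; [|apply is_clim_conj, (ip_correct v u); assumption].
intro n. induction n as [|n IH].
- rewrite !csum_O. conj_push. ring.
- rewrite !csum_S, <- IH. conj_push. ring.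
Qed.

Lemma l2norm_term (u : cseq) (j : nat) : in_l2 u -> (Cmod (u j) <= l2norm u)%R.
Proof.
intro Hu. unfold l2norm. rewrite <- (sqrt_pow2 (Cmod (u j))) by apply Cmod_ge_0.
apply sqrt_le_1_alt, (Series_ge_term (fun j => (Cmod (u j) ^ 2)%R)); [|exact Hu].
intro. apply pow2_ge_0.
Qed.

Lemma in_l2_sub (u v : cseq) : in_l2 u -> in_l2 v -> in_l2 (seq_sub u v).
Proof.
intros Hu Hv. apply (in_l2_ext (fun j => RtoC 1 * u j + RtoC (- 1) * v j)).
- intro j. unfold seq_sub. rewrite ?RtoC_opp. ring.
- now apply in_l2_lincomb.
Qed.

(* Summing |u_j||v_j| <= t |u_j|^2 + |v_j|^2 / t with t = l2norm v; the
   constant is not the Cauchy-Schwarz one, but only continuity matters. *)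
Lemma CSeries_l2_bound (u v : cseq) : in_l2 u -> in_l2 v ->
  (Rabs (Re (CSeries (fun j => (u j * v j)%C))) <= (l2norm u ^ 2 + 1) * l2norm v)%R /\
  (Rabs (Im (CSeries (fun j => (u j * v j)%C))) <= (l2norm u ^ 2 + 1) * l2norm v)%R.
Proof.
intros Hu Hv.
pose proof (in_l2_mult u v Hu Hv) as Huv.
assert (K : (Series (fun j => Cmod (u j * v j)%C) <= (l2norm u ^ 2 + 1) * l2norm v)%R).
{ assert (H0 : forall w, in_l2 w -> (0 <= Series (fun j => (Cmod (w j) ^ 2)%R))%R).
  { intros w Hw. eapply Rle_trans; [|apply (Series_ge_term _ 0%nat); [|exact Hw]].
    - apply pow2_ge_0.
    - intro. apply pow2_ge_0. }
  assert (Hn : forall w, in_l2 w -> (l2norm w ^ 2 = Series (fun j => (Cmod (w j) ^ 2)%R))%R).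
  { intros w Hw. unfold l2norm. apply pow2_sqrt, H0, Hw. }
  assert (Hpos : (0 <= l2norm v)%R) by apply sqrt_pos.
  destruct (Req_dec (l2norm v) 0) as [E|E].
  - rewrite E, Rmult_0_r. right.
    apply is_series_unique, is_series_zero. intro j. rewrite Cmod_mult.
    pose proof (l2norm_term v j Hv). pose proof (Cmod_ge_0 (v j)).
    replace (Cmod (v j)) with 0%R by lra. ring.
  - set (t := l2norm v) in *. assert (Ht : (0 < t)%R) by lra.
    apply Rle_trans with (Series (fun j => (t * Cmod (u j) ^ 2 + / t * Cmod (v j) ^ 2)%R)).
    + apply Series_le.
      * intro j. split; [apply Cmod_ge_0|]. rewrite Cmod_mult.
        set (x := Cmod (u j)). set (y := Cmod (v j)).
        assert (0 <= x)%R by apply Cmod_ge_0. assert (0 <= y)%R by apply Cmod_ge_0.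
        assert (Hi : (0 < / t)%R) by now apply Rinv_0_lt_compat.
        (* The expanded square bounds 2xy by t x^2 + y^2 / t. After summation, y^2 / t contributes
           t^2 / t = t, whence the factor [l2norm u ^ 2 + 1]. *)
        assert (E1 : (0 <= / t * (t * x - y) ^ 2)%R).
        { apply Rmult_le_pos; [lra|apply pow2_ge_0]. }
        replace (/ t * (t * x - y) ^ 2)%R with (t * x ^ 2 - 2 * (x * y) + / t * y ^ 2)%R in E1
          by (field; lra).
        nra.
      * apply (ex_series_plus (V := R_NormedModule) (fun j => (t * Cmod (u j) ^ 2)%R));
        apply (ex_series_scal_l (V := R_NormedModule)); assumption.
    + rewrite Series_plus, !Series_scal_l;
        [|apply (ex_series_scal_l (V := R_NormedModule)); assumption ..].
      rewrite <- (Hn u Hu), <- (Hn v Hv). fold t. right. field. lra. }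
split.
- eapply Rle_trans; [|exact K].
  change (Re (CSeries (fun j => u j * v j)%C)) with (Series (fun j => Re (u j * v j))).
  eapply Rle_trans; [apply Series_Rabs|apply Series_le; [|exact Huv]].
  + apply (ex_series_le_R _ (fun j => Cmod (u j * v j)%C)); [|exact Huv].
    intro n. split; [apply Rabs_pos|apply re_le_Cmod].
  + intro n. split; [apply Rabs_pos|apply re_le_Cmod].
- eapply Rle_trans; [|exact K].
  change (Im (CSeries (fun j => u j * v j)%C)) with (Series (fun j => Im (u j * v j))).
  eapply Rle_trans; [apply Series_Rabs|apply Series_le; [|exact Huv]].
  + apply (ex_series_le_R _ (fun j => Cmod (u j * v j)%C)); [|exact Huv].
    intro n. split; [apply Rabs_pos|apply im_le_Cmod].
  + intro n. split; [apply Rabs_pos|apply im_le_Cmod].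
Qed.

Lemma CSeries_minus_r (w u v : cseq) : in_l2 w -> in_l2 u -> in_l2 v ->
  CSeries (fun j => w j * seq_sub u v j) =
  CSeries (fun j => w j * u j) - CSeries (fun j => w j * v j).
Proof.
intros Hw Hu Hv. apply CSeries_unique.
eapply is_clim_ext; [|apply is_clim_minus; apply CSeries_l2; eassumption].
intro n. simpl. induction n as [|n IH].
- rewrite !csum_O. unfold seq_sub. rewrite ?RtoC_opp. ring.
- rewrite !csum_S, <- IH. unfold seq_sub. rewrite ?RtoC_opp. ring.
Qed.

(** The constant in [CSeries_l2_bound] depends only on the fixed factor w, so the pairing is
    continuous in the other factor. The boundary maps are thereby continuous in the graph norm. *)
Lemma l2_convergence_weak (w u : cseq) (un : nat -> cseq) :
  in_l2 w -> in_l2 u -> (forall n, in_l2 (un n)) ->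
  is_lim_seq (fun n => l2norm (seq_sub (un n) u)) 0%R ->
  is_clim (fun n => CSeries (fun j => w j * un n j)) (CSeries (fun j => w j * u j)).
Proof.
intros Hw Hu Hun Hlim.
assert (H0 : is_lim_seq (fun n => ((l2norm w ^ 2 + 1) * l2norm (seq_sub (un n) u))%R) 0%R).
{ replace 0%R with ((l2norm w ^ 2 + 1) * 0)%R by ring.
  apply (is_lim_seq_scal_l _ _ 0%R Hlim). }
assert (HD : is_clim (fun n => CSeries (fun j => w j * seq_sub (un n) u j)) 0).
{ split; apply is_lim_seq_abs_0;
    (eapply is_lim_seq_le_le; [|apply is_lim_seq_const|exact H0]);
    intro n; (split; [apply Rabs_pos|]);
    apply (CSeries_l2_bound w (seq_sub (un n) u) Hw (in_l2_sub _ _ (Hun n) Hu)). }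
pose proof (is_clim_plus _ _ _ _ HD (is_clim_const (CSeries (fun j => w j * u j)))) as H.
rewrite Cplus_0_l in H. eapply is_clim_ext; [|exact H].
intro n. simpl. rewrite CSeries_minus_r by auto. ring.
Qed.

Lemma l2_convergence_pointwise (u : cseq) (un : nat -> cseq) (j : nat) :
  in_l2 u -> (forall n, in_l2 (un n)) ->
  is_lim_seq (fun n => l2norm (seq_sub (un n) u)) 0%R ->
  is_clim (fun n => un n j) (u j).
Proof.
intros Hu Hun Hlim.
assert (HD : is_clim (fun n => seq_sub (un n) u j) 0).
{ split; apply is_lim_seq_abs_0;
    (eapply is_lim_seq_le_le; [|apply is_lim_seq_const|exact Hlim]);
    intro n; (split; [apply Rabs_pos|]);
    (eapply Rle_trans; [|apply (l2norm_term _ j (in_l2_sub _ _ (Hun n) Hu))]).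
  - apply re_le_Cmod.
  - apply im_le_Cmod. }
pose proof (is_clim_plus _ _ _ _ HD (is_clim_const (u j))) as H.
rewrite Cplus_0_l in H. eapply is_clim_ext; [|exact H].
intro n. simpl. unfold seq_sub. rewrite ?RtoC_opp. ring.
Qed.

Definition truncation (n : nat) (u : cseq) : cseq :=
  fun j => if (j <=? n)%nat then u j else 0.

Lemma truncation_dense (u : cseq) (eps : R) : in_l2 u -> (0 < eps)%R ->
  exists n, (l2norm (seq_sub u (truncation n u)) < eps)%R.
Proof.
intros Hu Heps.
set (a := fun j => (Cmod (u j) ^ 2)%R).
assert (Ha : is_lim_seq (sum_n a) (Series a)) by exact (Series_correct a Hu).
pose proof (proj2 (is_lim_seq_spec _ _) Ha) as Ha'.
assert (He2 : (0 < eps ^ 2)%R) by (apply pow_lt; exact Heps).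
destruct (Ha' (mkposreal _ He2)) as [n Hn]. exists n.
(* The squared norm of the remainder is the tail of the series of u. *)
assert (E : is_series (fun j => (Cmod (seq_sub u (truncation n u) j) ^ 2)%R)
              (Series a - sum_n a n)%R).
{ apply is_series_lim_seq.
  apply is_lim_seq_ext_loc with (fun m => (sum_n a m - sum_n a n)%R).
  - exists n. intros m Hm. induction Hm as [|m Hm IH].
    + rewrite Rminus_diag. symmetry. apply sum_n_zero. intros k Hk.
      unfold seq_sub, truncation. rewrite (proj2 (Nat.leb_le k n) Hk).
      replace (u k - u k) with (RtoC 0) by ring. rewrite Cmod_0. ring.
    + rewrite !sum_n_S, <- IH. unfold a at 2, seq_sub, truncation.
      rewrite (proj2 (Nat.leb_gt (S m) n)) by lia.
      replace (u (S m) - 0) with (u (S m)) by ring. simpl. ring.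
  - apply is_lim_seq_minus'; [exact Ha|apply is_lim_seq_const]. }
unfold l2norm. rewrite (is_series_unique _ _ E).
rewrite <- (sqrt_pow2 eps) by lra.
apply sqrt_lt_1_alt. specialize (Hn n (Nat.le_refl n)). simpl pos in Hn.
pose proof (sum_n_le_Series a n (fun j => pow2_ge_0 _) Hu).
rewrite Rabs_minus_sym, Rabs_pos_eq in Hn; lra.
Qed.

(** * Jacobi recurrences and Wronskians *)

Definition unit_seq (n : nat) : cseq := fun j => if (j =? n)%nat then 1 else 0.

Lemma unit_seq_eq (n : nat) : unit_seq n n = 1.
Proof. unfold unit_seq. now rewrite Nat.eqb_refl. Qed.

Lemma unit_seq_neq (n j : nat) : j <> n -> unit_seq n j = 0.
Proof. intro H. unfold unit_seq. now rewrite (proj2 (Nat.eqb_neq j n) H). Qed.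

Definition wronskian (B : nat -> R) (u v : cseq) (n : nat) : C :=
  RtoC (B n) * (u n * v (S n) - u (S n) * v n).

Section Jacobi.

Context (A B : nat -> R) (HB : forall j, (0 < B j)%R).

Let J := jacobi A B.
Let W := wronskian B.

Lemma B_neq_0 (j : nat) : RtoC (B j) <> 0.
Proof. apply RtoC_neq_0. specialize (HB j). lra. Qed.

Lemma jacobi_lincomb (a b : C) (u v : cseq) (j : nat) :
  J (fun k => a * u k + b * v k) j = a * J u j + b * J v j.
Proof. unfold J, jacobi. destruct j; ring. Qed.

Lemma jacobi_conj (u : cseq) (j : nat) :
  J (fun k => Cconj (u k)) j = Cconj (J u j).
Proof.
unfold J, jacobi. destruct j; conj_push; reflexivity.
Qed.

Lemma jacobi_finite (u : cseq) (N : nat) :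
  (forall j, (N <= j)%nat -> u j = 0) -> forall j, (S N <= j)%nat -> J u j = 0.
Proof.
intros H [|j] Hj; [lia|]. unfold J, jacobi. rewrite !H by lia. ring.
Qed.

(** The sum telescopes: the diagonal terms cancel, neighbouring off-diagonal terms cancel, and there
    is no term at the lower end because the row of index 0 has no left neighbour. *)
Lemma lagrange_identity (u v : cseq) (n : nat) :
  csum (fun j => u j * J v j - J u j * v j) n = W u v n.
Proof.
unfold J, W, wronskian. induction n as [|n IH].
- rewrite csum_O. unfold jacobi. ring.
- rewrite csum_S, IH. unfold jacobi. ring.
Qed.

Lemma wronskian_S (u v : cseq) (n : nat) :
  W u v (S n) = W u v n + (u (S n) * J v (S n) - J u (S n) * v (S n)).
Proof. now rewrite <- !lagrange_identity, csum_S. Qed.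

Lemma wronskian_finite (u v : cseq) (N : nat) :
  (forall j, (N <= j)%nat -> u j = 0) -> forall n, (N <= n)%nat -> W u v n = 0.
Proof. intros H n Hn. unfold W, wronskian. rewrite !H by lia. ring. Qed.

(** The row of index 0 already determines w_1 from w_0, so a solution on all rows has one free
    parameter. The induction carries two consecutive zeros. *)
Lemma jacobi_start_zero (z : C) (w : cseq) :
  (forall j, J w j = z * w j) -> w 0%nat = 0 -> forall j, w j = 0.
Proof.
intros H H0.
assert (K : forall j, w j = 0 /\ w (S j) = 0).
{ induction j as [|j [IH1 IH2]].
  - split; [exact H0|]. specialize (H 0%nat). unfold J, jacobi in H.
    rewrite H0 in H. apply (Cmult_cancel_0 (RtoC (B 0%nat))); [apply B_neq_0|].
    ring_simplify in H. exact H.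
  - split; [exact IH2|]. specialize (H (S j)). unfold J, jacobi in H.
    rewrite IH1, IH2 in H. apply (Cmult_cancel_0 (RtoC (B (S j)))); [apply B_neq_0|].
    ring_simplify in H. exact H. }
intro j. apply K.
Qed.

Lemma jacobi_eigen_polyP (z : C) (u : cseq) :
  (forall j, J u j = z * u j) -> forall j, u j = u 0%nat * polyP A B z j.
Proof.
intros H j.
assert (E : 1 * u j + (- u 0%nat) * polyP A B z j = 0).
{ apply (jacobi_start_zero z (fun k => 1 * u k + (- u 0%nat) * polyP A B z k)).
  - intro k. rewrite jacobi_lincomb, H. unfold J. rewrite polyP_jacobi by exact HB. ring.
  - unfold polyP. simpl. ring. }
replace (u j) with (1 * u j + (- u 0%nat) * polyP A B z j + u 0%nat * polyP A B z j)
  by ring.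
rewrite E. ring.
Qed.

(** Q solves the recurrence only from row 1 on; row 0 leaves the source B_0 Q_1 = 1. *)
Lemma polyQ_jacobi (z : C) (j : nat) :
  J (polyQ A B z) j = z * polyQ A B z j + unit_seq 0 j.
Proof.
destruct j as [|j].
- unfold J, jacobi, polyQ, unit_seq. simpl. field. apply B_neq_0.
- rewrite unit_seq_neq by lia. unfold J, polyQ.
  rewrite jsol_jacobi by (exact HB || lia). ring.
Qed.

(** In Lagrange's identity only the source of Q at index 0 survives, and it is weighted by P_0 =
    1. *)
Lemma wronskian_polyPQ (z : C) (n : nat) :
  W (polyP A B z) (polyQ A B z) n = 1.
Proof.
rewrite <- lagrange_identity.
rewrite (csum_ext _ (fun j => polyP A B z j * unit_seq 0 j)).
- rewrite (csum_tail _ 0); [|intros j Hj; rewrite unit_seq_neq by lia; ring|lia].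
  rewrite csum_O, unit_seq_eq. unfold polyP. simpl. ring.
- intro j. rewrite polyQ_jacobi. unfold J. rewrite polyP_jacobi by exact HB. ring.
Qed.

(** * The limit-circle case *)

(** [ker_shift] with parameter i is the kernel of Tmax + i, hence the eigenvalue -i. *)
Let z := - Ci.
Let P' := polyP A B z.
Let Q' := polyQ A B z.

(* Lagrange's identity for c P' + m Q' and its conjugate. *)
Lemma weyl_identity (m c : C) (n : nat) :
  c * P' (S n) + m * Q' (S n) = 0 ->
  sum_n (fun j => (Cmod (c * P' j + m * Q' j) ^ 2)%R) n = (- Im (c * Cconj m))%R.
Proof.
intro Hn. set (g := fun j => c * P' j + m * Q' j).
assert (Jg : forall j, J g j = z * g j + m * unit_seq 0 j).
{ intro j. unfold g. rewrite jacobi_lincomb. unfold Q'. rewrite polyQ_jacobi.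
  unfold P', J. rewrite polyP_jacobi by exact HB. ring. }
pose proof (lagrange_identity g (fun j => Cconj (g j)) n) as L.
assert (E : W g (fun j => Cconj (g j)) n = 0).
{ unfold W, wronskian. change (g (S n)) with (c * P' (S n) + m * Q' (S n)).
  rewrite Hn, Cconj_RtoC. ring. }
rewrite E in L.
(* The factor 2i is conj z - z; the source at index 0 contributes c conj(m) minus its conjugate,
   since the combination takes the value c there. *)
assert (L' : csum (fun j => RtoC (Cmod (g j) ^ 2)%R) n * (2 * Ci) +
   (c * Cconj m - Cconj (c * Cconj m)) = 0).
{ rewrite <- L. clear L E Hn. induction n as [|n IH].
  - rewrite !csum_O, jacobi_conj, Jg, unit_seq_eq, Cmod2_conj.
    replace (g 0%nat) with c by (unfold g, P', Q', polyP, polyQ; simpl; ring).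
    unfold z. conj_push. ring.
  - rewrite !csum_S, jacobi_conj, Jg, unit_seq_neq, Cmod2_conj by lia.
    rewrite <- IH. unfold z. conj_push. rewrite ?Cconj_RtoC. ring. }
rewrite csum_RtoC, im_alt' in L'.
assert (L2 : RtoC (sum_n (fun j => (Cmod (g j) ^ 2)%R) n + Im (c * Cconj m))%R = 0).
{ apply (Cmult_cancel_0 (2 * Ci)).
  - intro H. apply (f_equal Im) in H. change (2 * 1 + 0 * 0 = 0)%R in H. lra.
  - rewrite <- L', RtoC_plus. ring. }
apply RtoC_inj in L2.
change (sum_n (fun j => (Cmod (g j) ^ 2)%R) n = (- Im (c * Cconj m))%R). lra.
Qed.

(** At a zero, [weyl_identity] with c = 1 and m = 0 would make a sum of squares vanish whose first
    term is 1. *)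
Lemma polyP_neq_0_at_z (n : nat) : P' (S n) <> 0.
Proof.
intro H.
assert (E := weyl_identity 0 1 n).
rewrite H in E. specialize (E ltac:(ring)).
rewrite Cconj_RtoC in E. replace (1 * 0) with (RtoC 0) in E by ring.
change (Im 0) with 0%R in E.
pose proof (sum_n_ge_term (fun j => (Cmod (1 * P' j + 0 * Q' j) ^ 2)%R) 0 n
  (fun j => pow2_ge_0 _) (Nat.le_0_l n)) as K.
simpl in E. simpl in K. rewrite E in K.
replace (1 * P' 0%nat + 0 * Q' 0%nat) with (RtoC 1) in K
  by (unfold P', Q', polyP, polyQ; simpl; ring).
rewrite Cmod_1 in K. lra.
Qed.

(** For each n, choose c so that c P' + Q' vanishes at n + 1. The identity bounds its square sum up
    to n by -Im c, and the term of index 0 is |c|^2. Hence |c|^2 <= -Im c <= |c|, so |c| <= 1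
    uniformly in n: the Weyl discs are bounded. Subtracting c P' bounds the partial sums for Q'. *)
Lemma polyQ_in_l2_at_z : in_l2 P' -> in_l2 Q'.
Proof.
intro HP.
assert (Hpos : forall x, (0 <= Cmod x ^ 2)%R) by (intro; apply pow2_ge_0).
apply (ex_series_bounded _ (2 + 2 * Series (fun j => (Cmod (P' j) ^ 2)%R))%R); [auto|].
intro n. set (c := - (Q' (S n) / P' (S n))).
pose proof (polyP_neq_0_at_z n) as H0.
assert (E := weyl_identity 1 c n).
specialize (E ltac:(unfold c; field; exact H0)).
rewrite Cconj_RtoC in E. replace (c * 1) with c in E by ring.
assert (Hc : (Cmod c ^ 2 <= - Im c)%R).
{ rewrite <- E. pose proof (sum_n_ge_term (fun j => (Cmod (c * P' j + 1 * Q' j) ^ 2)%R) 0 n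
    (fun j => pow2_ge_0 _) (Nat.le_0_l n)) as K. cbv beta in K.
  replace (c * P' 0%nat + 1 * Q' 0%nat) with c in K
    by (unfold P', Q', polyP, polyQ; simpl; ring). exact K. }
assert (Hi : (- Im c <= Cmod c)%R).
{ pose proof (im_le_Cmod c). pose proof (Rle_abs (- Im c)). rewrite Rabs_Ropp in *. lra. }
pose proof (Cmod_ge_0 c) as Hm.
assert (Hm1 : (Cmod c <= 1)%R) by nra.
assert (K : forall k, (sum_n (fun j => (Cmod (Q' j) ^ 2)%R) k <=
  2 * sum_n (fun j => (Cmod (c * P' j + 1 * Q' j) ^ 2)%R) k +
  2 * sum_n (fun j => (Cmod (P' j) ^ 2)%R) k)%R).
{ assert (T : forall j, (Cmod (Q' j) ^ 2 <= 2 * Cmod (c * P' j + 1 * Q' j) ^ 2 +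
    2 * Cmod (P' j) ^ 2)%R).
  { intro j. replace (Q' j) with ((c * P' j + 1 * Q' j) + (- c) * P' j) at 1 by ring.
    eapply Rle_trans; [apply Cmod_plus_sq|]. rewrite (Cmod_mult (- c)), Cmod_opp.
    assert ((Cmod c * Cmod (P' j)) ^ 2 <= Cmod (P' j) ^ 2)%R; [|lra].
    rewrite Rpow_mult_distr. specialize (Hpos (P' j)). nra. }
  induction k as [|k IH]; [rewrite !sum_O; apply T|].
  rewrite !sum_n_S.
  specialize (T (S k)). simpl in *. lra. }
specialize (K n).
pose proof (sum_n_le_Series (fun j => (Cmod (P' j) ^ 2)%R) n (fun j => Hpos _) HP).
lra.
Qed.

Lemma Cmod_z : Cmod z = 1%R.
Proof. unfold z. rewrite Cmod_opp. apply Cmod_Ci. Qed.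

(* Variation of constants: the coefficients of u in the basis P', Q' are
   Wronskians, which grow at most like prod (1 + (|P'_j| + |Q'_j|)^2). *)
Lemma limit_circle (u : cseq) : in_l2 P' -> in_l2 Q' ->
  (forall j, J u (S j) = 0) -> in_l2 u.
Proof.
intros HP HQ Hu.
set (s := fun j => (Cmod (P' j) + Cmod (Q' j))%R).
assert (Hs0 : forall j, (0 <= s j)%R).
{ intro j. unfold s. pose proof (Cmod_ge_0 (P' j)). pose proof (Cmod_ge_0 (Q' j)). lra. }
assert (Hs : ex_series (fun j => (s j ^ 2)%R)).
{ apply (ex_series_le_R _ (fun j => plus (scal 2%R (Cmod (P' j) ^ 2)%R)
    (scal 2%R (Cmod (Q' j) ^ 2)%R))).
  - intro j. split; [apply pow2_ge_0|]. unfold s, plus, scal; simpl. unfold mult; simpl.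
    pose proof (pow2_ge_0 (Cmod (P' j) - Cmod (Q' j))). nra.
  - apply (ex_series_plus (V := R_NormedModule));
      apply (ex_series_scal_l (V := R_NormedModule)); assumption. }
set (a := fun n => (Cmod (W u P' n) + Cmod (W u Q' n))%R).
assert (Ha0 : forall n, (0 <= a n)%R).
{ intro n. unfold a. pose proof (Cmod_ge_0 (W u P' n)). pose proof (Cmod_ge_0 (W u Q' n)). lra. }
assert (Hua : forall n, (Cmod (u (S n)) <= a n * s (S n))%R).
(* Cramer's rule: u_(n+1) is recovered from its Wronskians with P' and Q', the determinant being
   W(P', Q') = 1. *)
{ intro n. pose proof (wronskian_polyPQ z n) as E.
  replace (u (S n)) with (W u Q' n * P' (S n) + - (W u P' n * Q' (S n))).
  - eapply Rle_trans; [apply Cmod_triangle|]. rewrite Cmod_opp, !Cmod_mult.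
    unfold a, s. pose proof (Cmod_ge_0 (W u P' n)). pose proof (Cmod_ge_0 (W u Q' n)).
    pose proof (Cmod_ge_0 (P' (S n))). pose proof (Cmod_ge_0 (Q' (S n))). nra.
  - replace (u (S n)) with (u (S n) * W (polyP A B z) (polyQ A B z) n)
      by (rewrite E; ring).
    unfold W, wronskian, P', Q'. ring. }
assert (Hstep : forall n, (a (S n) <= a n * (1 + s (S n) ^ 2))%R).
{ intro n.
  (* Here u has spectral parameter 0 and P', Q' have z, so a Wronskian changes by z u P' or z u Q'
     only. *)
  assert (E1 : W u P' (S n) = W u P' n + z * (u (S n) * P' (S n))).
  { rewrite wronskian_S, Hu. unfold P' at 2, J. rewrite polyP_jacobi by exact HB.
    fold P'. ring. }
  assert (E2 : W u Q' (S n) = W u Q' n + z * (u (S n) * Q' (S n))).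
  { rewrite wronskian_S, Hu. unfold Q' at 2. rewrite polyQ_jacobi, unit_seq_neq by lia.
    fold Q'. ring. }
  unfold a at 1. rewrite E1, E2.
  pose proof (Cmod_triangle (W u P' n) (z * (u (S n) * P' (S n)))) as T1.
  pose proof (Cmod_triangle (W u Q' n) (z * (u (S n) * Q' (S n)))) as T2.
  rewrite !Cmod_mult, Cmod_z in T1, T2.
  specialize (Hua n). specialize (Hs0 (S n)).
  assert (Cmod (u (S n)) * s (S n) <= a n * s (S n) * s (S n))%R
    by (apply Rmult_le_compat_r; assumption).
  unfold a, s in *. nra. }
(* The product of the factors 1 + s^2 is bounded through 1 + x <= exp x; the extra term s_0^2 in the
   exponent only enlarges the bound. *)
assert (Hbound : forall n, (a n <= a 0%nat * exp (sum_n (fun j => (s j ^ 2)%R) n))%R).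
{ induction n as [|n IH].
  - rewrite sum_O. pose proof (exp_ineq1_le (s 0%nat ^ 2)). pose proof (pow2_ge_0 (s 0%nat)).
    specialize (Ha0 0%nat). nra.
  - rewrite sum_n_S, exp_plus.
    eapply Rle_trans; [apply Hstep|].
    rewrite <- Rmult_assoc. apply Rmult_le_compat; [apply Ha0| |exact IH|apply exp_ineq1_le].
    pose proof (pow2_ge_0 (s (S n))). lra. }
set (K := (a 0%nat * exp (Series (fun j => (s j ^ 2)%R)))%R).
assert (HK : forall n, (a n <= K)%R).
{ intro n. eapply Rle_trans; [apply Hbound|]. apply Rmult_le_compat_l; [apply Ha0|].
  destruct (sum_n_le_Series (fun j => (s j ^ 2)%R) n (fun j => pow2_ge_0 _) Hs) as [H|H].
  - left. now apply exp_increasing.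
  - right. now rewrite H. }
apply (ex_series_incr_1 (V := R_NormedModule)).
apply (ex_series_le_R _ (fun j => scal (K ^ 2)%R (s (S j) ^ 2)%R)).
- intro n. split; [apply pow2_ge_0|]. unfold scal; simpl. unfold mult; simpl.
  pose proof (Cmod_ge_0 (u (S n))) as Hc.
  assert (H : (Cmod (u (S n)) <= K * s (S n))%R).
  { eapply Rle_trans; [apply Hua|]. apply Rmult_le_compat_r; auto. }
  nra.
- apply (ex_series_scal_l (V := R_NormedModule)).
  apply (ex_series_incr_1 (V := R_NormedModule)) in Hs. exact Hs.
Qed.

(** A vector f in the kernel is f_0 P'. Linear independence of the basis forbids f = 0, so f_0 can
    be divided out. *)
Lemma deficiency_polyP (Hdef : deficiency_indices A B 1 1) : in_l2 P'.
Proof.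
destruct Hdef as [[e [He [Hfree _]]] _].
destruct (He 0%nat (Nat.lt_0_1)) as [Hl2 [_ Hj]].
set (f := e 0%nat) in *.
assert (Ef : forall j, f j = f 0%nat * P' j).
{ apply jacobi_eigen_polyP. intro j. unfold J. rewrite <- Hj. unfold z. ring. }
assert (H0 : f 0%nat <> 0).
{ intro H0. assert (E : RtoC 1 = RtoC 0).
  { apply (Hfree (fun _ => RtoC 1)) with (k := 0%nat); [|lia].
    intro j. simpl. fold f. rewrite Ef, H0. ring. }
  apply RtoC_inj in E. lra. }
apply (in_l2_ext (fun j => / f 0%nat * f j + 0 * f j)).
- intro j. rewrite (Ef j). field. exact H0.
- now apply in_l2_lincomb.
Qed.

(** The equation is imposed from row 1 on, so that Q qualifies along with P. *)
Lemma deficiency_solutions (Hdef : deficiency_indices A B 1 1) (u : cseq) :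
  (forall j, J u (S j) = 0) -> in_l2 u.
Proof.
pose proof (deficiency_polyP Hdef) as HP.
apply limit_circle; [exact HP|now apply polyQ_in_l2_at_z].
Qed.

End Jacobi.

(** * Boundary values *)

Definition in_dom_max (A B : nat -> R) (u : cseq) : Prop :=
  in_l2 u /\ in_l2 (jacobi A B u).

Lemma Tmax_iff (A B : nat -> R) (u v : cseq) :
  Tmax A B u v <-> in_dom_max A B u /\ v = jacobi A B u.
Proof.
split.
- intros [Hu [Hv E]].
  assert (E' : v = jacobi A B u) by (apply functional_extensionality, E).
  subst v. now repeat split.
- intros [[Hu HJ] ->]. now repeat split.
Qed.

Section Boundary.

Context (A B : nat -> R) (HB : forall j, (0 < B j)%R)
  (Hdef : deficiency_indices A B 1 1).

Let J := jacobi A B.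
Let W := wronskian B.
Let P := polyP A B 0.
Let Q := polyQ A B 0.
Let D := in_dom_max A B.
Let G0 := Gamma0 A B.
Let G1 := Gamma1 A B.

Lemma polyP0_jacobi (j : nat) : J P j = 0.
Proof. unfold J, P. rewrite polyP_jacobi by exact HB. ring. Qed.

Lemma polyQ0_jacobi (j : nat) : J Q j = unit_seq 0 j.
Proof. unfold J, Q. rewrite polyQ_jacobi by exact HB. ring. Qed.

Lemma polyP0_real (j : nat) : P j = RtoC (Re (P j)).
Proof.
assert (H0 : B 0%nat <> 0%R) by (specialize (HB 0%nat); lra).
destruct (jsol_real A B HB 0 1 ((0 - A 0%nat) / B 0%nat)%R j) as [p Hp].
unfold P, polyP. rewrite <- RtoC_minus, <- RtoC_div, Hp by exact H0. reflexivity.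
Qed.

Lemma polyQ0_real (j : nat) : Q j = RtoC (Re (Q j)).
Proof.
assert (H0 : B 0%nat <> 0%R) by (specialize (HB 0%nat); lra).
destruct (jsol_real A B HB 0 0 (/ B 0%nat)%R j) as [q Hq].
unfold Q, polyQ. rewrite <- RtoC_inv, Hq by exact H0. reflexivity.
Qed.

Lemma polyP0_conj (j : nat) : Cconj (P j) = P j.
Proof. rewrite polyP0_real. apply Cconj_RtoC. Qed.

Lemma polyQ0_conj (j : nat) : Cconj (Q j) = Q j.
Proof. rewrite polyQ0_real. apply Cconj_RtoC. Qed.

Lemma polyP0_in_l2 : in_l2 P.
Proof.
apply (deficiency_solutions A B HB Hdef). intro j. apply (polyP0_jacobi (S j)).
Qed.

Lemma polyQ0_in_l2 : in_l2 Q.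
Proof.
apply (deficiency_solutions A B HB Hdef). intro j. fold J.
rewrite polyQ0_jacobi. apply unit_seq_neq. lia.
Qed.

Lemma in_dom_max_lincomb (a b : C) (u v : cseq) :
  D u -> D v -> D (fun j => a * u j + b * v j).
Proof.
intros [Hu HJu] [Hv HJv]. split; [now apply in_l2_lincomb|].
apply (in_l2_ext (fun j => a * J u j + b * J v j)).
- intro j. symmetry. apply jacobi_lincomb.
- now apply in_l2_lincomb.
Qed.

Lemma in_dom_max_conj (u : cseq) : D u -> D (fun j => Cconj (u j)).
Proof.
intros [Hu HJu]. split; [now apply in_l2_conj|].
apply (in_l2_ext (fun j => Cconj (J u j))).
- intro j. symmetry. apply jacobi_conj.
- now apply in_l2_conj.
Qed.

Lemma in_dom_max_finite (u : cseq) (N : nat) :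
  (forall j, (N <= j)%nat -> u j = 0) -> D u.
Proof.
intro H. split; [now apply in_l2_finite with N|].
apply (in_l2_finite _ (S N)), (jacobi_finite A B u N H).
Qed.

Lemma in_dom_max_polyP : D P.
Proof.
split; [apply polyP0_in_l2|]. apply (in_l2_finite _ 0). intros j _. apply polyP0_jacobi.
Qed.

Lemma in_dom_max_polyQ : D Q.
Proof.
split; [apply polyQ0_in_l2|]. apply (in_l2_finite _ 1). intros j Hj. fold J.
rewrite polyQ0_jacobi. apply unit_seq_neq. lia.
Qed.

(** Both halves of the sum in Lagrange's identity converge, being sums of products of
    square-summable sequences. *)
Lemma wronskian_clim (u v : cseq) : D u -> D v ->
  is_clim (W u v) (CSeries (fun j => u j * J v j) - CSeries (fun j => J u j * v j)).
Proof.
intros [Hu HJu] [Hv HJv].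
eapply is_clim_ext; [|apply is_clim_minus; apply CSeries_l2; eassumption].
intro n. unfold W. rewrite <- (lagrange_identity A B). fold J. cbv beta.
induction n as [|n IH].
- rewrite !csum_O. reflexivity.
- rewrite !csum_S, <- IH. ring.
Qed.

Lemma Gamma0_clim (u : cseq) : D u -> is_clim (W P u) (G0 u).
Proof.
intro Hu. replace (G0 u) with
  (CSeries (fun j => P j * J u j) - CSeries (fun j => J P j * u j)).
- apply wronskian_clim; [apply in_dom_max_polyP|exact Hu].
- rewrite (CSeries_single (fun j => J P j * u j) 0); cbv beta; rewrite ?polyP0_jacobi.
  + unfold G0, Gamma0, P, J. ring.
  + intros j _. rewrite polyP0_jacobi. ring.
Qed.

(** The source of Q at index 0 accounts for the term -u_0 in [Gamma1]. *)
Lemma Gamma1_clim (u : cseq) : D u -> is_clim (W Q u) (G1 u).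
Proof.
intro Hu. replace (G1 u) with
  (CSeries (fun j => Q j * J u j) - CSeries (fun j => J Q j * u j)).
- apply wronskian_clim; [apply in_dom_max_polyQ|exact Hu].
- rewrite (CSeries_single (fun j => J Q j * u j) 0); cbv beta; rewrite ?polyQ0_jacobi.
  + rewrite unit_seq_eq. unfold G1, Gamma1, Q, J. ring.
  + intros j Hj. rewrite polyQ0_jacobi, unit_seq_neq by exact Hj. ring.
Qed.

Lemma Gamma0_lincomb (a b : C) (u v : cseq) : D u -> D v ->
  G0 (fun j => a * u j + b * v j) = a * G0 u + b * G0 v.
Proof.
intros Hu Hv. eapply is_clim_unique.
- apply Gamma0_clim. now apply in_dom_max_lincomb.
- eapply is_clim_ext; [|apply is_clim_plus; apply is_clim_mult;
    [apply is_clim_const|apply Gamma0_clim, Hu|apply is_clim_const|apply Gamma0_clim, Hv]].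
  intro n. unfold W, wronskian. ring.
Qed.

Lemma Gamma1_lincomb (a b : C) (u v : cseq) : D u -> D v ->
  G1 (fun j => a * u j + b * v j) = a * G1 u + b * G1 v.
Proof.
intros Hu Hv. eapply is_clim_unique.
- apply Gamma1_clim. now apply in_dom_max_lincomb.
- eapply is_clim_ext; [|apply is_clim_plus; apply is_clim_mult;
    [apply is_clim_const|apply Gamma1_clim, Hu|apply is_clim_const|apply Gamma1_clim, Hv]].
  intro n. unfold W, wronskian. ring.
Qed.

Lemma Gamma0_finite (u : cseq) (N : nat) :
  (forall j, (N <= j)%nat -> u j = 0) -> G0 u = 0.
Proof.
intro H. eapply is_clim_unique; [apply Gamma0_clim, (in_dom_max_finite u N H)|].
apply (is_clim_eventually_const _ _ N). intros n Hn.
unfold W, wronskian. rewrite !H by lia. ring.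
Qed.

Lemma Gamma1_finite (u : cseq) (N : nat) :
  (forall j, (N <= j)%nat -> u j = 0) -> G1 u = 0.
Proof.
intro H. eapply is_clim_unique; [apply Gamma1_clim, (in_dom_max_finite u N H)|].
apply (is_clim_eventually_const _ _ N). intros n Hn.
unfold W, wronskian. rewrite !H by lia. ring.
Qed.

(* Pluecker's relation expresses W(f, conj g) through the Wronskians of f and
   conj g with P and Q, because W(P, Q) = 1. *)
Lemma green_formula (f g : cseq) : D f -> D g ->
  ip (J f) g - ip f (J g) = G1 f * Cconj (G0 g) - G0 f * Cconj (G1 g).
Proof.
intros Hf Hg.
replace (ip (J f) g - ip f (J g)) with
  (- (CSeries (fun j => f j * J (fun k => Cconj (g k)) j) -
      CSeries (fun j => J f j * Cconj (g j)))).
- eapply is_clim_unique.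
  + apply is_clim_opp, (wronskian_clim f (fun k => Cconj (g k)));
      [exact Hf|now apply in_dom_max_conj].
  + eapply is_clim_ext; [|apply is_clim_minus; apply is_clim_mult;
      [apply Gamma1_clim, Hf|apply is_clim_conj, Gamma0_clim, Hg|
       apply Gamma0_clim, Hf|apply is_clim_conj, Gamma1_clim, Hg]].
    intro n. cbv beta.
    replace (W f (fun k => Cconj (g k)) n) with (W P Q n * W f (fun k => Cconj (g k)) n).
    * unfold W, wronskian. conj_push. rewrite !polyP0_conj, !polyQ0_conj. ring.
    * unfold W, P, Q. rewrite wronskian_polyPQ by exact HB. ring.
- unfold ip.
  rewrite (CSeries_ext (fun j => f j * J (fun k => Cconj (g k)) j)
    (fun j => f j * Cconj (J g j))); [ring|].
  intro j. unfold J. rewrite jacobi_conj. reflexivity.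
Qed.

(** The Wronskians among P and Q are constant, so P and Q have the boundary values (0, -1) and (1,
    0), and a Q - b P does what is required. *)
Lemma Gamma_surjective (a b : C) : exists f, D f /\ G0 f = a /\ G1 f = b.
Proof.
assert (HPQ : forall n, W P Q n = 1) by (intro n; apply wronskian_polyPQ, HB).
assert (E0P : G0 P = 0).
{ eapply is_clim_unique; [apply Gamma0_clim, in_dom_max_polyP|].
  apply (is_clim_eventually_const _ _ 0). intros n _. unfold W, wronskian. ring. }
assert (E1Q : G1 Q = 0).
{ eapply is_clim_unique; [apply Gamma1_clim, in_dom_max_polyQ|].
  apply (is_clim_eventually_const _ _ 0). intros n _. unfold W, wronskian. ring. }
assert (E0Q : G0 Q = 1).
{ eapply is_clim_unique; [apply Gamma0_clim, in_dom_max_polyQ|].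
  apply (is_clim_eventually_const _ _ 0). intros n _. apply HPQ. }
assert (E1P : G1 P = - (1)).
{ eapply is_clim_unique; [apply Gamma1_clim, in_dom_max_polyP|].
  apply (is_clim_eventually_const _ _ 0). intros n _. rewrite <- (HPQ n).
  unfold W, wronskian. ring. }
exists (fun j => a * Q j + (- b) * P j). split; [|split].
- apply in_dom_max_lincomb; [apply in_dom_max_polyQ|apply in_dom_max_polyP].
- rewrite Gamma0_lincomb, E0P, E0Q by (apply in_dom_max_polyQ || apply in_dom_max_polyP).
  ring.
- rewrite Gamma1_lincomb, E1P, E1Q by (apply in_dom_max_polyQ || apply in_dom_max_polyP).
  ring.
Qed.

Lemma Gamma_boundary_triplet : boundary_triplet (Tmax A B) G0 G1.
Proof.
split.
- intros f f' g g' Hf Hg. apply Tmax_iff in Hf, Hg.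
  destruct Hf as [Hf ->], Hg as [Hg ->]. now apply green_formula.
- intros a b. destruct (Gamma_surjective a b) as [f [Hf E]].
  exists f. split; [|exact E]. exists (J f). now apply Tmax_iff.
Qed.

(** * Self-adjoint extensions *)

Lemma Tpremin_iff (u v : cseq) : Tpremin A B u v <->
  (exists N : nat, forall j, (N <= j)%nat -> u j = 0) /\ v = J u.
Proof.
split; intros [H E]; (split; [exact H|]).
- apply functional_extensionality, E.
- intro j. now rewrite E.
Qed.

(** A real line in homogeneous coordinates: (1, h) is the finite parameter h and (0, 1) the infinite
    one, so both cases share their proofs. *)
Definition boundary_condition (a b : R) (u : cseq) : Prop :=
  RtoC a * G1 u = RtoC b * G0 u.

Lemma Text_iff (h : Rbar) (u v : cseq) : Text A B h u v <->
  D u /\ v = J u /\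
  match h with
  | Finite r => boundary_condition 1 r u
  | _ => boundary_condition 0 1 u
  end.
Proof.
unfold Text. rewrite Tmax_iff. fold G0 G1 D J.
assert (E : (G0 u = 0) <-> boundary_condition 0 1 u).
{ unfold boundary_condition. split; intro H.
  - rewrite H. ring.
  - replace (G0 u) with (1 * G0 u) by ring. rewrite <- H. ring. }
destruct h as [r| |]; [|tauto|tauto].
assert (E' : (G1 u - RtoC r * G0 u = 0) <-> boundary_condition 1 r u); [|tauto].
unfold boundary_condition. split; intro H.
- replace (G1 u) with ((G1 u - RtoC r * G0 u) + RtoC r * G0 u) by ring.
  rewrite H. ring.
- rewrite <- H. ring.
Qed.

Definition boundary_restriction (a b : R) : graph := fun u v =>
  D u /\ v = J u /\ boundary_condition a b u.

Lemma Tpremin_boundary_restriction (a b : R) :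
  extends (boundary_restriction a b) (Tpremin A B).
Proof.
intros u v H. apply Tpremin_iff in H. destruct H as [[N HN] ->].
split; [now apply in_dom_max_finite with N|split; [reflexivity|]].
unfold boundary_condition.
rewrite (Gamma0_finite u N HN), (Gamma1_finite u N HN). ring.
Qed.

(** Unit vectors belong to the preminimal operator; testing the adjoint relation against the k-th
    one reads off g_k = (J f)_k. *)
Lemma adjoint_extension_Tmax (S : graph) (f g : cseq) :
  extends S (Tpremin A B) -> adjoint S f g -> Tmax A B f g.
Proof.
intros HS [Hf [Hg H]]. split; [exact Hf|split; [exact Hg|]]. intro k.
assert (Hk : forall j, (k + 1 <= j)%nat -> unit_seq k j = 0)
  by (intros j Hj; apply unit_seq_neq; lia).
assert (Hsum : forall x : cseq, CSeries (fun j => unit_seq k j * x j) = x k).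
{ intro x. rewrite (CSeries_single _ k).
  - rewrite unit_seq_eq. ring.
  - intros j Hj. rewrite unit_seq_neq by exact Hj. ring. }
assert (E : ip (J (unit_seq k)) f = Cconj (J f k)).
{ apply CSeries_unique, (is_clim_eventually_const _ _ (k + 1)). intros n Hn.
  (* Beyond the support of the unit vector the Wronskian is 0, so J can be moved to the other factor
     without a boundary term. *)
  assert (E0 := lagrange_identity A B (unit_seq k) (fun j => Cconj (f j)) n).
  rewrite (wronskian_finite B _ _ (k + 1) Hk n Hn) in E0.
  assert (E1 : csum (fun j => unit_seq k j * Cconj (J f j)) n = Cconj (J f k)).
  { rewrite (csum_tail _ k), csum_first, unit_seq_eq; [ring| | |lia].
    - intros j Hj. rewrite unit_seq_neq by lia. ring.
    - intros j Hj. rewrite unit_seq_neq by lia. ring. }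
  rewrite <- E1. replace (csum (fun j => J (unit_seq k) j * Cconj (f j)) n) with
    (csum (fun j => J (unit_seq k) j * Cconj (f j)) n + 0) by ring.
  rewrite <- E0. clear E0 E1 Hn. induction n as [|n IH].
  - rewrite !csum_O, jacobi_conj. fold J. ring.
  - rewrite !csum_S, <- IH, jacobi_conj. fold J. ring. }
assert (E2 : ip (unit_seq k) g = Cconj (g k)).
{ apply (Hsum (fun j => Cconj (g j))). }
rewrite <- (H (unit_seq k) (J (unit_seq k))), E in E2.
- rewrite <- (Cconj_conj (g k)), <- E2, Cconj_conj. reflexivity.
- apply HS, Tpremin_iff. split; [now exists (k + 1)%nat|reflexivity].
Qed.

(** Since a and b are real, the boundary vectors of f and of conj g lie on one line, and the
    right-hand side of Green's formula is their determinant. *)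
Lemma boundary_restriction_symmetric (a b : R) (f g : cseq) :
  (a <> 0 \/ b <> 0)%R -> D f -> D g ->
  boundary_condition a b f -> boundary_condition a b g ->
  ip (J f) g = ip f (J g).
Proof.
intros Hab Hf Hg Cf Cg.
assert (E : G1 f * Cconj (G0 g) - G0 f * Cconj (G1 g) = 0).
{ unfold boundary_condition in *.
  apply (f_equal Cconj) in Cg. rewrite !Cmult_conj, !Cconj_RtoC in Cg.
  destruct Hab as [Ha|Hb].
  - apply (Cmult_cancel_0 (RtoC a)); [now apply RtoC_neq_0|].
    transitivity ((RtoC a * G1 f) * Cconj (G0 g) - G0 f * (RtoC a * Cconj (G1 g)));
      [ring|rewrite Cf, Cg; ring].
  - apply (Cmult_cancel_0 (RtoC b)); [now apply RtoC_neq_0|].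
    transitivity (G1 f * (RtoC b * Cconj (G0 g)) - (RtoC b * G0 f) * Cconj (G1 g));
      [ring|rewrite <- Cf, <- Cg; ring]. }
rewrite <- (green_formula f g Hf Hg) in E.
replace (ip (J f) g) with (ip (J f) g - ip f (J g) + ip f (J g)) by ring.
rewrite E. ring.
Qed.

Lemma boundary_restriction_self_adjoint (a b : R) :
  (a <> 0 \/ b <> 0)%R -> self_adjoint (boundary_restriction a b).
Proof.
intro Hab. split; [|split].
- split; [|split; [|split]].
  + intros u v [[H1 H2] [-> _]]. now split.
  + exists (fun _ => 0), (J (fun _ => 0)). apply Tpremin_boundary_restriction.
    apply Tpremin_iff. split; [now exists 0%nat|reflexivity].
  + intros x y u v u' v' [Hu [-> Cu]] [Hu' [-> Cu']].
    split; [now apply in_dom_max_lincomb|split].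
    * apply functional_extensionality. intro j. symmetry. apply jacobi_lincomb.
    * unfold boundary_condition in *.
      rewrite Gamma0_lincomb, Gamma1_lincomb by assumption.
      transitivity (x * (RtoC a * G1 u) + y * (RtoC a * G1 u')); [ring|].
      rewrite Cu, Cu'. ring.
  + intros u v v' [_ [-> _]] [_ [-> _]]. reflexivity.
- intros u Hu eps Heps. destruct (truncation_dense u eps Hu Heps) as [n Hn].
  exists (truncation n u). split; [|exact Hn].
  exists (J (truncation n u)). apply Tpremin_boundary_restriction, Tpremin_iff.
  split; [|reflexivity]. exists (S n). intros j Hj. unfold truncation.
  now rewrite (proj2 (Nat.leb_gt j n)) by lia.
- intros f g. split.
  + intros [Hf [-> Cf]]. split; [apply Hf|split; [apply Hf|]].
    intros u v [Hu [-> Cu]]. now apply (boundary_restriction_symmetric a b).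
  + intro H. pose proof H as [_ [_ Hip]].
    apply (adjoint_extension_Tmax _ _ _ (Tpremin_boundary_restriction a b)) in H.
    apply Tmax_iff in H. destruct H as [Hf ->]. split; [exact Hf|split; [reflexivity|]].
    (* A vector with boundary values (a, b) satisfies the condition itself; Green's formula against
       it turns membership in the adjoint into the condition on f. *)
    destruct (Gamma_surjective (RtoC a) (RtoC b)) as [u [Hu [E0 E1]]].
    assert (E := green_formula u f Hu Hf).
    unfold J in E at 1 2. rewrite (Hip u (jacobi A B u)), E0, E1 in E.
    * unfold boundary_condition.
      replace (ip u (jacobi A B f) - ip u (J f)) with (RtoC 0) in E by (unfold J; ring).
      apply (f_equal Cconj) in E.
      rewrite !Cminus_conj, !Cmult_conj, !Cconj_conj, !Cconj_RtoC in E.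
      replace (RtoC a * G1 f) with (RtoC b * G0 f - (RtoC b * G0 f - RtoC a * G1 f)) by ring.
      rewrite <- E. ring.
    * split; [exact Hu|split; [reflexivity|]]. unfold boundary_condition.
      rewrite E0, E1. ring.
Qed.

(** [Gamma0] and [Gamma1] are built from pairings of J u with P and Q and the evaluation u_0. All
    are continuous along the approximating sequences, so both maps vanish on the closure. *)
Lemma closure_boundary_restriction (a b : R) :
  extends (boundary_restriction a b) (Tmin A B).
Proof.
intros u v [Hu [Hv [un [vn [HT [Hlu Hlv]]]]]].
assert (Hn : forall n, D (un n) /\ vn n = J (un n) /\ G0 (un n) = 0 /\ G1 (un n) = 0).
{ intro n. specialize (HT n). apply Tpremin_iff in HT. destruct HT as [[N HN] E].
  split; [now apply in_dom_max_finite with N|split; [exact E|split]].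
  - now apply Gamma0_finite with N.
  - now apply Gamma1_finite with N. }
assert (Hun : forall n, in_l2 (un n)) by (intro n; apply (Hn n)).
assert (Hvn : forall n, in_l2 (vn n)).
{ intro n. destruct (Hn n) as [[_ H] [-> _]]. exact H. }
(* Each row of J involves at most three entries, so pointwise convergence suffices. *)
assert (Ev : v = J u).
{ apply functional_extensionality. intro j. eapply is_clim_unique.
  - apply (l2_convergence_pointwise v vn j Hv Hvn Hlv).
  - apply (is_clim_ext (fun n => J (un n) j)).
    + intro n. destruct (Hn n) as [_ [-> _]]. reflexivity.
    + pose proof (fun k => l2_convergence_pointwise u un k Hu Hun Hlu) as Hk.
      unfold J, jacobi. apply is_clim_plus; [apply is_clim_plus|].
      * apply is_clim_mult; [apply is_clim_const|apply Hk].
      * apply is_clim_mult; [apply is_clim_const|apply Hk].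
      * destruct j; [apply is_clim_const|].
        apply is_clim_mult; [apply is_clim_const|apply Hk]. }
subst v. assert (Du : D u) by now split.
assert (E0 : G0 u = 0).
{ eapply is_clim_unique.
  - apply (l2_convergence_weak P (J u) vn); auto using polyP0_in_l2.
  - apply (is_clim_eventually_const _ _ 0). intros n _.
    destruct (Hn n) as [_ [-> [E _]]]. exact E. }
assert (E1 : G1 u = 0).
{ eapply is_clim_unique.
  - apply is_clim_minus.
    + apply (l2_convergence_weak Q (J u) vn); auto using polyQ0_in_l2.
    + apply (l2_convergence_pointwise u un 0 Hu Hun Hlu).
  - apply (is_clim_eventually_const _ _ 0). intros n _. cbv beta.
    destruct (Hn n) as [_ [-> [_ E]]]. exact E. }
split; [exact Du|split; [reflexivity|]]. unfold boundary_condition. rewrite E0, E1. ring.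
Qed.

Lemma Tmin_extends_Tpremin : extends (Tmin A B) (Tpremin A B).
Proof.
intros u v H. assert (H' := H). apply Tpremin_iff in H'. destruct H' as [[N HN] E].
destruct (in_dom_max_finite u N HN) as [H1 H2]. fold J in H2. rewrite <- E in H2.
assert (L : forall w : cseq, is_lim_seq (fun _ : nat => l2norm (seq_sub w w)) 0%R).
{ intro w. replace (l2norm (seq_sub w w)) with 0%R; [apply is_lim_seq_const|].
  unfold l2norm. rewrite <- sqrt_0. f_equal. symmetry.
  apply is_series_unique, is_series_zero. intro j. unfold seq_sub.
  replace (w j - w j) with (RtoC 0) by ring. rewrite Cmod_0. ring. }
split; [exact H1|split; [exact H2|]].
exists (fun _ => u), (fun _ => v). split; [intros _; exact H|split; apply L].
Qed.

(** Taking adjoints reverses inclusion: T equals its adjoint, which lies in the adjoint of S, that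
    is, in S. *)
Lemma self_adjoint_maximal (S T : graph) :
  self_adjoint S -> self_adjoint T -> (forall u v, S u v -> T u v) -> same_graph S T.
Proof.
intros [_ [_ HS]] [_ [_ HT]] H u v. split; [apply H|].
intro Hu. apply HT in Hu. destruct Hu as [H1 [H2 H3]]. apply HS.
split; [exact H1|split; [exact H2|]]. intros u' v' H'. apply H3, H, H'.
Qed.

(** Symmetry makes the Green form vanish on the boundary values of S. If some u has Gamma_0 u
    nonzero, pairing u with itself shows that h = Gamma_1 u / Gamma_0 u is real, and pairing any
    other element with u puts it on the line of slope h. Otherwise Gamma_0 vanishes on the whole
    domain. Either way S lies in a self-adjoint restriction and equals it by maximality. *)
Lemma self_adjoint_extension_classification (S : graph) :
  self_adjoint S -> extends S (Tpremin A B) ->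
  same_graph S (boundary_restriction 0 1) \/
  exists r : R, same_graph S (boundary_restriction 1 r).
Proof.
intros HS Hext. pose proof HS as [_ [_ Hadj]].
assert (HD : forall u v, S u v -> D u /\ v = J u).
{ intros u v H. apply Hadj in H.
  apply Tmax_iff, (adjoint_extension_Tmax S u v Hext H). }
assert (Hsym : forall u v u' v', S u v -> S u' v' ->
  G1 u * Cconj (G0 u') = G0 u * Cconj (G1 u')).
{ intros u v u' v' H H'. destruct (HD u v H) as [Hu ->].
  destruct (HD u' v' H') as [Hu' ->].
  assert (E := green_formula u u' Hu Hu').
  pose proof (proj1 (Hadj _ _) H') as [_ [_ Hip]].
  rewrite (Hip u (J u) H) in E.
  replace (G1 u * Cconj (G0 u')) with
    (G0 u * Cconj (G1 u') + (G1 u * Cconj (G0 u') - G0 u * Cconj (G1 u'))) by ring.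
  rewrite <- E. ring. }
destruct (classic (exists u v, S u v /\ G0 u <> 0)) as [[u [v [Hu H0]]]|Hno].
- right. set (h := G1 u / G0 u).
  assert (H0' : Cconj (G0 u) <> 0).
  { intro E. apply H0. rewrite <- (Cconj_conj (G0 u)), E. apply Cconj_RtoC. }
  assert (Hh : Cconj h = h).
  { unfold h. rewrite Cdiv_conj by exact H0. pose proof (Hsym u v u v Hu Hu) as E.
    replace (Cconj (G1 u)) with (G0 u * Cconj (G1 u) / G0 u) by (field; exact H0).
    rewrite <- E. field. now split. }
  assert (Er : RtoC (Re h) = h).
  { rewrite re_alt, Hh. field. }
  exists (Re h). apply self_adjoint_maximal; [exact HS| |].
  + apply boundary_restriction_self_adjoint. left. lra.
  + intros u' v' Hu'. destruct (HD u' v' Hu') as [Du' E].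
    split; [exact Du'|split; [exact E|]]. unfold boundary_condition. rewrite Er.
    pose proof (Hsym u' v' u v Hu' Hu) as E'.
    rewrite <- Hh. unfold h. rewrite Cdiv_conj by exact H0.
    replace (1 * G1 u') with (G1 u' * Cconj (G0 u) / Cconj (G0 u)) by (field; exact H0').
    rewrite E'. field. exact H0'.
- left. apply self_adjoint_maximal; [exact HS| |].
  + apply boundary_restriction_self_adjoint. right. lra.
  + intros u v Hu. destruct (HD u v Hu) as [Du E].
    split; [exact Du|split; [exact E|]]. unfold boundary_condition.
    replace (G0 u) with (RtoC 0); [ring|].
    symmetry. apply NNPP. intro H. apply Hno. now exists u, v.
Qed.

End Boundary.

(** * Non-negativity *)

Definition splice (n : nat) (u v : cseq) : cseq :=
  fun j => if (j <=? n)%nat then u j else v j.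

Lemma splice_le (n : nat) (u v : cseq) (j : nat) :
  (j <= n)%nat -> splice n u v j = u j.
Proof. intro H. unfold splice. now rewrite (proj2 (Nat.leb_le j n) H). Qed.

Lemma splice_gt (n : nat) (u v : cseq) (j : nat) :
  (n < j)%nat -> splice n u v j = v j.
Proof. intro H. unfold splice. now rewrite (proj2 (Nat.leb_gt j n) H). Qed.

(** Rows n and n + 1 are the only ones that see both pieces of a splice; this and the next three
    lemmas list the rows. *)
Lemma jacobi_splice_lt (A B : nat -> R) (n : nat) (u v : cseq) (j : nat) :
  (j < n)%nat -> jacobi A B (splice n u v) j = jacobi A B u j.
Proof. intro H. unfold jacobi. destruct j; rewrite !splice_le by lia; reflexivity. Qed.

Lemma jacobi_splice_eq (A B : nat -> R) (n : nat) (u v : cseq) :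
  jacobi A B (splice n u v) n = jacobi A B u n + RtoC (B n) * (v (S n) - u (S n)).
Proof.
unfold jacobi. rewrite splice_gt by lia. destruct n; rewrite !splice_le by lia; ring.
Qed.

Lemma jacobi_splice_S (A B : nat -> R) (n : nat) (u v : cseq) :
  jacobi A B (splice n u v) (S n) = jacobi A B v (S n) + RtoC (B n) * (u n - v n).
Proof. unfold jacobi. rewrite !splice_gt, splice_le by lia. ring. Qed.

Lemma jacobi_splice_gt (A B : nat -> R) (n : nat) (u v : cseq) (j : nat) :
  (S n < j)%nat -> jacobi A B (splice n u v) j = jacobi A B v j.
Proof. intro H. unfold jacobi. destruct j; [lia|]. rewrite !splice_gt by lia. reflexivity. Qed.

(* If the limit were negative, the inequality S_n + eps <= - D_n r_(n+1) would
   propagate to S_n + eps >= - c r_(n+1), hence D_n >= c, for some c > 0. *)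
Lemma abel_limit_nonneg (d r : nat -> R) (l : R) :
  r 0%nat = 0%R -> (forall n, (r (S n) < r n)%R) -> (forall n, (0 <= d n)%R) ->
  is_lim_seq d 0%R ->
  is_lim_seq (fun n => (sum_n (fun j => d j * (r j - r (S j)))%R n + d n * r (S n))%R) l ->
  (0 <= l)%R.
Proof.
intros Hr0 Hr Hd Hd0 Hl.
destruct (Rle_or_lt 0 l) as [H|Hneg]; [exact H|exfalso].
assert (Hrneg : forall n, (r (S n) < 0)%R).
{ induction n as [|n IH]; [rewrite <- Hr0; apply Hr|].
  apply Rlt_trans with (1 := Hr (S n)) (2 := IH). }
set (s := sum_n (fun j => d j * (r j - r (S j)))%R) in *.
assert (Hs : forall n, s (S n) = (s n + d (S n) * (r (S n) - r (S (S n))))%R).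
{ intro n. unfold s. rewrite sum_n_S. reflexivity. }
assert (Hs0 : forall n, (0 <= s n)%R).
{ intro n. apply sum_n_nonneg. intro j. apply Rmult_le_pos; [apply Hd|].
  specialize (Hr j). lra. }
(* With l = -2 eps, the sequence is eventually at most l + eps = -eps. *)
set (eps := (- l / 2)%R). assert (Heps : (0 < eps)%R) by (unfold eps; lra).
destruct (proj2 (is_lim_seq_spec _ _) Hl (mkposreal _ Heps)) as [N HN].
assert (HG : forall n, (N <= n)%nat -> (s n + d n * r (S n) <= - eps)%R).
{ intros n Hn. specialize (HN n Hn). simpl in HN. apply Rabs_def2 in HN.
  unfold eps in *. lra. }
(* This c gives equality in the invariant at its starting index N. *)
set (c := ((s N + eps) / - r (S N))%R).
assert (Hc : (0 < c)%R).
{ specialize (Hs0 N). specialize (Hrneg N). apply Rdiv_lt_0_compat; lra. }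
assert (Hinv : forall n, (N <= n)%nat -> (c * - r (S n) <= s n + eps)%R /\ (c <= d (S n))%R).
{ assert (K : forall n, (N <= n)%nat -> (c * - r (S n) <= s n + eps)%R -> (c <= d (S n))%R).
  { intros n Hn H. specialize (HG (S n) ltac:(lia)). rewrite Hs in HG.
    specialize (Hrneg n).
    apply Rmult_le_reg_r with (- r (S n))%R; lra. }
  intros n Hn. induction Hn as [|n Hn IH].
  - assert (H : (c * - r (S N) <= s N + eps)%R).
    { right. unfold c. field. specialize (Hrneg N). lra. }
    split; [exact H|now apply K].
  - destruct IH as [IH1 IH2].
    assert (H : (c * - r (S (S n)) <= s (S n) + eps)%R).
    { rewrite Hs. specialize (Hr (S n)).
      assert (c * (r (S n) - r (S (S n))) <= d (S n) * (r (S n) - r (S (S n))))%R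
        by (apply Rmult_le_compat_r; lra).
      lra. }
    split; [exact H|apply K; [lia|exact H]]. }
destruct (proj2 (is_lim_seq_spec _ _) Hd0 (mkposreal _ Hc)) as [M HM].
specialize (HM (S (N + M)) ltac:(lia)). simpl in HM.
destruct (Hinv (N + M)%nat ltac:(lia)) as [_ H].
apply Rabs_def2 in HM. lra.
Qed.

(** The sum has non-negative terms and may be dropped; a finite limit of r is what makes d_n r_(n+1)
    converge. *)
Lemma abel_limit_ge (d r : nat -> R) (d' l a : R) :
  (forall n, (r (S n) < r n)%R) -> (forall n, (0 <= d n)%R) ->
  is_lim_seq d d' -> is_lim_seq r a ->
  is_lim_seq (fun n => (sum_n (fun j => d j * (r j - r (S j)))%R n + d n * r (S n))%R) l ->
  (d' * a <= l)%R.
Proof.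
intros Hr Hd Hdl Hra Hl.
apply is_lim_seq_incr_1 in Hra.
pose proof (is_lim_seq_mult' _ _ _ _ Hdl Hra) as H.
change (Rbar_le (d' * a)%R l). refine (is_lim_seq_le _ _ _ _ _ H Hl).
intro n. cbv beta.
assert (0 <= sum_n (fun j => d j * (r j - r (S j)))%R n)%R; [|lra].
apply sum_n_nonneg. intro j. apply Rmult_le_pos; [apply Hd|]. specialize (Hr j). lra.
Qed.

Section Positivity.

Context (A B : nat -> R) (HA : forall j, (0 < A j)%R) (HB : forall j, (0 < B j)%R)
  (Hnonneg : nonneg_operator (Tpremin A B)).

Let J := jacobi A B.
Let W := wronskian B.
Let P := polyP A B 0.
Let Q := polyQ A B 0.
Let D := in_dom_max A B.
Let G0 := Gamma0 A B.
Let G1 := Gamma1 A B.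
Let p := fun j => Re (P j).
Let q := fun j => Re (Q j).
Let r := ratioQP A B.

(* Test T on the truncation of P after index n, perturbed by a multiple of the
   next unit vector. *)
Lemma polyP0_alternates (n : nat) : p n <> 0%R -> (p n * p (S n) < 0)%R.
Proof.
intro Hp. pose proof (HB n) as Hb. pose proof (HA (S n)) as Ha.
(* The form of the test vector is A_(n+1) t^2 + 2 B_n p_n t - B_n p_n p_(n+1), and this t minimizes
   it. It also annihilates row n + 1 of J f. Since t p_n < 0, the resulting bound p_n p_(n+1) <= t
   p_n is strictly negative. *)
set (t := (- (B n * p n / A (S n)))%R).
set (v := fun j => RtoC t * unit_seq (S n) j).
set (f := splice n P v).
assert (Hv : forall j, j <> S n -> v j = 0).
{ intros j Hj. unfold v. rewrite unit_seq_neq by exact Hj. ring. }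
assert (HvS : v (S n) = RtoC t) by (unfold v; rewrite unit_seq_eq; ring).
assert (Hf : forall j, (S (S n) <= j)%nat -> f j = 0).
{ intros j Hj. unfold f. rewrite splice_gt by lia. apply Hv. lia. }
destruct (Hnonneg f (J f)) as [_ H].
{ split; [now exists (S (S n))|reflexivity]. }
assert (PR : forall j, P j = RtoC (p j)) by (intro j; apply (polyP0_real A B HB)).
assert (E : ip (J f) f = RtoC (B n * (t - p (S n)) * p n + (A (S n) * t + B n * p n) * t)%R).
{ apply CSeries_unique, (is_clim_eventually_const _ _ (S n)). intros m Hm.
  rewrite (csum_tail _ (S n)); [|intros j Hj; rewrite Hf by lia; rewrite Cconj_RtoC; ring|exact Hm].
  rewrite csum_S, csum_first.
  - unfold J, f. rewrite jacobi_splice_eq, jacobi_splice_S, splice_le, splice_gt by lia.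
    pose proof (polyP0_jacobi A B HB n) as E0. fold P in E0. rewrite E0.
    assert (E1 : jacobi A B v (S n) = RtoC (A (S n) * t)%R).
    { unfold jacobi. rewrite (Hv (S (S n))), (Hv n), HvS by lia. rewrite RtoC_mult. ring. }
    rewrite E1, HvS, (Hv n), !PR, !Cconj_RtoC by lia.
    rewrite !RtoC_plus, !RtoC_mult, !RtoC_plus, !RtoC_minus, !RtoC_mult. ring.
  - intros j Hj. unfold J, f. rewrite jacobi_splice_lt by exact Hj.
    pose proof (polyP0_jacobi A B HB j) as E0. fold P in E0. rewrite E0. ring. }
rewrite E, re_RtoC in H. clear E.
replace (A (S n) * t + B n * p n)%R with 0%R in H by (unfold t; field; lra).
assert (Hp2 : (0 < p n * p n)%R) by nra.
assert (Ht : (t * p n < 0)%R).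
{ unfold t. replace (- (B n * p n / A (S n)) * p n)%R with (- (B n * (p n * p n) / A (S n)))%R
    by (field; lra).
  assert (0 < B n * (p n * p n) / A (S n))%R; [|lra].
  apply Rdiv_lt_0_compat; [now apply Rmult_lt_0_compat|exact Ha]. }
assert (H' : (0 <= B n * (t * p n - p n * p (S n)))%R) by lra.
assert (0 <= t * p n - p n * p (S n))%R; [|lra].
apply Rmult_le_reg_l with (B n); lra.
Qed.

Lemma Re_polyP0_neq_0 (n : nat) : p n <> 0%R.
Proof.
induction n as [|n IH]; [unfold p, P, polyP; simpl; lra|].
pose proof (polyP0_alternates n IH) as H. intro E. rewrite E in H. lra.
Qed.

Lemma polyP0_neq_0 (n : nat) : P n <> 0.
Proof. intro E. apply (Re_polyP0_neq_0 n). unfold p. now rewrite E. Qed.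

Lemma ratioQP_polyP (n : nat) : RtoC (r n) * P n = Q n.
Proof.
unfold r. rewrite <- ratioQP_real; [|exact HB|apply polyP0_neq_0].
fold P Q. field. apply polyP0_neq_0.
Qed.

Lemma ratioQP_0 : r 0%nat = 0%R.
Proof.
apply RtoC_inj. pose proof (ratioQP_polyP 0) as H. unfold P, Q, polyP, polyQ in H. simpl in H.
rewrite <- H. ring.
Qed.

(** Dividing W(P, Q) = 1 by the negative number B_n p_n p_(n+1) gives r_(n+1) - r_n. *)
Lemma ratioQP_decreasing (n : nat) : (r (S n) < r n)%R.
Proof.
assert (Hq : forall j, q j = (r j * p j)%R).
{ intro j. unfold q. rewrite <- ratioQP_polyP. apply re_scal_l. }
assert (E : (B n * (p n * q (S n) - p (S n) * q n) = 1)%R).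
{ apply RtoC_inj. rewrite <- (wronskian_polyPQ A B HB 0 n). unfold wronskian. fold P Q.
  rewrite RtoC_mult, RtoC_minus, !RtoC_mult. unfold p, q.
  pose proof (polyP0_real A B HB) as EP. pose proof (polyQ0_real A B HB) as EQ.
  fold P in EP. fold Q in EQ. rewrite <- !EP, <- !EQ. reflexivity. }
rewrite !Hq in E. pose proof (polyP0_alternates n (Re_polyP0_neq_0 n)) as H.
specialize (HB n).
assert (E' : (B n * - (p n * p (S n)) * (r n - r (S n)) = 1)%R) by lra.
assert (0 < B n * - (p n * p (S n)))%R by (apply Rmult_lt_0_compat; lra).
apply Rnot_le_lt. intro Hle. nra.
Qed.

(* Abel summation in the coordinates W(P,u), W(Q,u) of u; the increments of
   -r are the weights 1 / (B_j |P_j P_(j+1)|) of the ground-state representation. *)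
Lemma form_identity (u : cseq) (n : nat) :
  csum (fun j => J u j * Cconj (u j)) n =
  RtoC (sum_n (fun j => Cmod (W P u j) ^ 2 * (r j - r (S j)))%R n +
    Cmod (W P u n) ^ 2 * r (S n))%R - W P u n * Cconj (W Q u n).
Proof.
assert (PC : forall j, Cconj (P j) = P j) by (intro; apply (polyP0_conj A B HB)).
assert (QC : forall j, Cconj (Q j) = Q j) by (intro; apply (polyQ0_conj A B HB)).
assert (HP : forall n, W P u (S n) = W P u n + P (S n) * J u (S n)).
{ intro k. unfold W. rewrite (wronskian_S A B).
  pose proof (polyP0_jacobi A B HB (S k)) as E. fold P in E. rewrite E. fold J. ring. }
assert (HQ : forall n, W Q u (S n) = W Q u n + Q (S n) * J u (S n)).
{ intro k. unfold W. rewrite (wronskian_S A B).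
  pose proof (polyQ0_jacobi A B HB (S k)) as E. fold Q in E.
  rewrite E, unit_seq_neq by lia. fold J. ring. }
assert (HPQ : forall n, u (S n) = W P u n * Q (S n) - W Q u n * P (S n)).
{ intro k. replace (u (S k)) with (u (S k) * W P Q k).
  - unfold W, wronskian. ring.
  - unfold W, P, Q. rewrite (wronskian_polyPQ A B HB). ring. }
assert (Hb0 : RtoC (B 0%nat) <> 0) by now apply B_neq_0.
rewrite RtoC_plus, RtoC_mult, Cmod2_conj.
induction n as [|n IH].
- rewrite csum_O, sum_O. cbv beta. rewrite RtoC_mult, Cmod2_conj, RtoC_minus, ratioQP_0.
  assert (E0 : W P u 0%nat = J u 0%nat).
  { unfold W. rewrite <- (lagrange_identity A B), csum_O.
    pose proof (polyP0_jacobi A B HB 0) as E. fold P in E. rewrite E. fold J.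
    unfold P, polyP. simpl. ring. }
  assert (E1 : W Q u 0%nat = - u 0%nat).
  { unfold W, wronskian, Q, polyQ. simpl. field. exact Hb0. }
  rewrite E0, E1, Copp_conj. ring.
- rewrite csum_S, IH, sum_n_S.
  rewrite RtoC_plus, RtoC_mult, Cmod2_conj, RtoC_minus, HP, HQ, HPQ.
  (* With Q_(n+1) = r_(n+1) P_(n+1) and real P, the step becomes a polynomial identity in the two
     Wronskians, P_(n+1) and the value of J u. *)
  rewrite <- (ratioQP_polyP (S n)). conj_push. rewrite !PC. ring.
Qed.

(** * The quadratic form on the maximal domain *)

Context (Hdef : deficiency_indices A B 1 1).

Lemma form_limit (u : cseq) : D u ->
  is_lim_seq (fun n => (sum_n (fun j => Cmod (W P u j) ^ 2 * (r j - r (S j)))%R n +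
    Cmod (W P u n) ^ 2 * r (S n))%R) (Re (ip (J u) u + G0 u * Cconj (G1 u))).
Proof.
intro Hu.
assert (H : is_clim (fun n => csum (fun j => J u j * Cconj (u j)) n +
   W P u n * Cconj (W Q u n)) (ip (J u) u + G0 u * Cconj (G1 u))).
{ apply is_clim_plus.
  - destruct Hu as [H1 H2]. now apply ip_correct.
  - apply is_clim_mult; [|apply is_clim_conj].
    + now apply Gamma0_clim.
    + now apply Gamma1_clim. }
destruct H as [H _]. eapply is_lim_seq_ext; [|exact H].
intro n. cbv beta. rewrite form_identity.
match goal with |- Re (?x - ?y + ?y) = _ => replace (x - y + y) with x by ring end.
apply re_RtoC.
Qed.

Lemma Cmod_wronskian_lim (u : cseq) : D u ->
  is_lim_seq (fun n => (Cmod (W P u n) ^ 2)%R) (Cmod (G0 u) ^ 2)%R.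
Proof. intro Hu. apply is_clim_Cmod2. now apply Gamma0_clim. Qed.

Lemma krein_form_nonneg (u : cseq) : D u -> G0 u = 0 -> (0 <= Re (ip (J u) u))%R.
Proof.
intros Hu H0. pose proof (form_limit u Hu) as H. pose proof (Cmod_wronskian_lim u Hu) as Hd.
rewrite H0 in H, Hd. rewrite Cmod_0 in Hd.
replace (0 ^ 2)%R with 0%R in Hd by ring.
replace (ip (J u) u + 0 * Cconj (G1 u)) with (ip (J u) u) in H by ring.
refine (abel_limit_nonneg _ r _ ratioQP_0 ratioQP_decreasing _ Hd H).
intro n. apply pow2_ge_0.
Qed.

Lemma form_nonneg (h a : R) (u : cseq) : D u -> is_lim_seq r a -> (h <= a)%R ->
  G1 u = RtoC h * G0 u -> (0 <= Re (ip (J u) u))%R.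
Proof.
intros Hu Ha Hh H1. pose proof (form_limit u Hu) as H.
pose proof (Cmod_wronskian_lim u Hu) as Hd.
pose proof (abel_limit_ge _ r _ _ a ratioQP_decreasing (fun n => pow2_ge_0 _) Hd Ha H) as K.
rewrite H1, Cmult_conj, Cconj_RtoC in K.
replace (G0 u * (RtoC h * Cconj (G0 u))) with (RtoC (h * Cmod (G0 u) ^ 2)%R) in K
  by (rewrite RtoC_mult, Cmod2_conj; ring).
rewrite re_plus, re_RtoC in K. pose proof (pow2_ge_0 (Cmod (G0 u))). nra.
Qed.

(* The witness equals (r_n - h) P up to index n and Q - h P from there on. *)
Lemma form_negative (h : R) (n : nat) : (r n < h)%R ->
  exists u, D u /\ G1 u = RtoC h * G0 u /\ (Re (ip (J u) u) < 0)%R.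
Proof.
intro Hn. pose proof (polyP0_neq_0 n) as HPn.
set (v := fun j => 1 * Q j + RtoC (- h) * P j).
set (w := fun j => RtoC (r n - h) * P j + 0 * P j).
set (u := splice n w v).
assert (JP : forall j, J P j = 0) by (intro; apply (polyP0_jacobi A B HB)).
assert (JQ : forall j, J Q j = unit_seq 0 j) by (intro; apply (polyQ0_jacobi A B HB)).
assert (Jw : forall j, J w j = 0).
{ intro j. unfold w, J. rewrite jacobi_lincomb. fold J. rewrite JP. ring. }
assert (Jv : forall j, (1 <= j)%nat -> J v j = 0).
{ intros j Hj. unfold v, J. rewrite jacobi_lincomb. fold J.
  rewrite JP, JQ, unit_seq_neq by lia. ring. }
(* The pieces agree at n because Q_n = r_n P_n, so row n + 1 sees no seam; for n = 0 the source of Q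
   lies in the discarded part of v. *)
assert (Ju : forall j, j <> n -> J u j = 0).
{ intros j Hj. unfold u, J. destruct (Nat.lt_total j n) as [H|[H|H]]; [|lia|].
  - rewrite jacobi_splice_lt by exact H. apply Jw.
  - destruct (Nat.eq_dec j (S n)) as [->|Hj'].
    + rewrite jacobi_splice_S. fold J. rewrite Jv by lia.
      unfold v, w. rewrite <- ratioQP_polyP, RtoC_minus, RtoC_opp. ring.
    + rewrite jacobi_splice_gt by lia. apply Jv. lia. }
(* The jump in row n is B_n (Q_(n+1) - r_n P_(n+1)) = W_n(P, Q) / P_n. *)
assert (Jun : J u n = / P n).
{ unfold u, J. rewrite jacobi_splice_eq. fold J. rewrite Jw.
  assert (E := wronskian_polyPQ A B HB 0 n). unfold wronskian in E. fold P Q in E.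
  rewrite <- (ratioQP_polyP n) in E.
  transitivity (1 / P n); [|field; exact HPn]. rewrite <- E at 1.
  unfold v, w. rewrite RtoC_minus, RtoC_opp. field. exact HPn. }
assert (Hu : D u).
{ split.
  - apply (in_l2_eventually u v (S n)).
    + intros j Hj. apply splice_gt. lia.
    + apply in_l2_lincomb; [apply (polyQ0_in_l2 A B HB Hdef)|apply (polyP0_in_l2 A B HB Hdef)].
  - apply (in_l2_finite _ (S n)). intros j Hj. apply Ju. lia. }
assert (E0 : G0 u = 1).
{ unfold G0, Gamma0. fold P J. rewrite (CSeries_single _ n).
  - rewrite Jun. field. exact HPn.
  - intros j Hj. rewrite Ju by exact Hj. ring. }
assert (E1 : G1 u = RtoC h).
{ unfold G1, Gamma1. fold Q J. rewrite (CSeries_single _ n).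
  - rewrite Jun, <- ratioQP_polyP. unfold u. rewrite splice_le by lia.
    unfold w. replace (P 0%nat) with (RtoC 1) by reflexivity.
    rewrite RtoC_minus. field. exact HPn.
  - intros j Hj. rewrite Ju by exact Hj. ring. }
exists u. split; [exact Hu|split; [rewrite E0, E1; ring|]].
assert (E : ip (J u) u = RtoC (r n - h)).
{ unfold ip. rewrite (CSeries_single _ n).
  - rewrite Jun. unfold u. rewrite splice_le by lia. unfold w. conj_push.
    pose proof (polyP0_conj A B HB n) as E. fold P in E. rewrite E. field. exact HPn.
  - intros j Hj. rewrite Ju by exact Hj. ring. }
rewrite E, re_RtoC. lra.
Qed.

(** * The limit of the ratios and the parametrization *)

Lemma ratioQP_limit : exists a : Rbar, is_lim_seq r a /\ Rbar_lt a p_infty.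
Proof.
destruct (ex_lim_seq_decr r) as [a Ha]; [intro n; left; apply ratioQP_decreasing|].
exists a. split; [exact Ha|].
assert (H : Rbar_le a 0%R).
{ apply (is_lim_seq_le r (fun _ => 0%R)); [|exact Ha|apply is_lim_seq_const].
  induction n as [|n IH]; [rewrite ratioQP_0; lra|].
  left. apply Rlt_le_trans with (1 := ratioQP_decreasing n) (2 := IH). }
destruct a; simpl in *; auto.
Qed.

Lemma boundary_restriction_extension (a b : R) : (a <> 0 \/ b <> 0)%R ->
  (forall u, D u -> boundary_condition A B a b u -> (0 <= Re (ip (J u) u))%R) ->
  nonneg_sa_extension A B (boundary_restriction A B a b).
Proof.
intros Hab H. split; [|split].
- now apply boundary_restriction_self_adjoint.
- now apply closure_boundary_restriction.
- intros u v [Hu [-> Cu]]. split; [|now apply H].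
  assert (E : ip (J u) u = ip u (J u))
    by now apply (boundary_restriction_symmetric A B HB Hdef a b).
  destruct Hu as [H1 H2]. rewrite (ip_conj u (J u) H1 H2) in E.
  apply (f_equal Im) in E. rewrite im_conj in E. fold J. lra.
Qed.

Lemma boundary_condition_finite (h : R) (u : cseq) :
  boundary_condition A B 1 h u <-> G1 u = RtoC h * G0 u.
Proof.
unfold boundary_condition. fold G0 G1. rewrite Cmult_1_l. tauto.
Qed.

Lemma boundary_condition_infinite (u : cseq) :
  boundary_condition A B 0 1 u <-> G0 u = 0.
Proof.
unfold boundary_condition. fold G0 G1. rewrite Cmult_1_l, Cmult_0_l.
split; congruence.
Qed.

(** Equality of graphs lets [Text] be rewritten as a [boundary_restriction] inside
    [nonneg_sa_extension]. *)
Lemma same_graph_eq (S T : graph) : same_graph S T -> S = T.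
Proof.
intro H. apply functional_extensionality. intro u. apply functional_extensionality. intro v.
apply propositional_extensionality, H.
Qed.

Lemma Text_nonneg_sa_extension (a h : Rbar) :
  is_lim_seq r a -> Rbar_lt a p_infty -> Rbar_le h a ->
  nonneg_sa_extension A B (Text A B h).
Proof.
intros Ha Hlt Hh.
assert (K : nonneg_sa_extension A B (boundary_restriction A B 0 1)).
{ apply boundary_restriction_extension; [right; lra|]. intros u Hu Cu.
  apply krein_form_nonneg; [exact Hu|]. now apply boundary_condition_infinite. }
destruct h as [h| |].
- destruct a as [a| |]; try contradiction.
  rewrite (same_graph_eq _ (boundary_restriction A B 1 h)); [|exact (Text_iff A B h)].
  apply boundary_restriction_extension; [left; lra|]. intros u Hu Cu.
  apply (form_nonneg h a); [exact Hu|exact Ha|exact Hh|].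
  now apply boundary_condition_finite.
- rewrite (same_graph_eq _ (boundary_restriction A B 0 1)); [exact K|exact (Text_iff A B p_infty)].
- rewrite (same_graph_eq _ (boundary_restriction A B 0 1)); [exact K|exact (Text_iff A B m_infty)].
Qed.

Lemma nonneg_sa_extension_Text (a : Rbar) (S : graph) : is_lim_seq r a ->
  nonneg_sa_extension A B S -> exists h, Rbar_le h a /\ same_graph S (Text A B h).
Proof.
intros Ha [Hsa [Hext Hpos]].
assert (Hext' : extends S (Tpremin A B)).
{ intros u v H. now apply Hext, Tmin_extends_Tpremin. }
destruct (self_adjoint_extension_classification A B HB Hdef S Hsa Hext') as [H|[h H]].
- exists m_infty. split; [now destruct a|].
  intros u v. rewrite Text_iff. apply H.
- exists (Finite h). split; [|intros u v; rewrite Text_iff; apply H].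
  apply Rbar_not_lt_le. intro Hlt.
  (* A parameter above the limit lies above some ratio, and [form_negative] then contradicts
     non-negativity. *)
  assert (Hn : exists n, (r n < h)%R).
  { apply NNPP. intro Hno.
    assert (Hle : Rbar_le h a); [|now apply Rbar_le_not_lt in Hle].
    apply (is_lim_seq_le (fun _ => h) r); [|apply is_lim_seq_const|exact Ha].
    intro n. apply Rnot_lt_le. intro Hn. apply Hno. now exists n. }
  destruct Hn as [n Hn]. destruct (form_negative h n Hn) as [u [Hu [Cu Hneg]]].
  destruct (Hpos u (J u)) as [_ Hp]; [|lra].
  apply H. split; [exact Hu|split; [reflexivity|now apply boundary_condition_finite]].
Qed.

Lemma Text_injective (h h' : Rbar) : Rbar_lt h p_infty -> Rbar_lt h' p_infty ->
  same_graph (Text A B h) (Text A B h') -> h = h'.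
Proof.
intros Hh Hh' H.
(* An element with boundary values (1, x) lies in the domain for x; a finite y must equal x, and -oo
   would force 1 = 0. Only the pair of two infinite parameters is left over, and it is trivial. *)
assert (K : forall (x : R) (y : Rbar), Rbar_lt y p_infty ->
  (forall u v, Text A B x u v -> Text A B y u v) -> Finite x = y).
{ intros x y Hy Hxy.
  destruct (Gamma_surjective A B HB Hdef 1 (RtoC x)) as [f [Hf [E0 E1]]].
  assert (Hx : Text A B x f (J f)).
  { apply Text_iff. split; [exact Hf|split; [reflexivity|]].
    apply boundary_condition_finite. fold G0 G1 in E0, E1. rewrite E0, E1. ring. }
  apply Hxy, Text_iff in Hx. destruct Hx as [_ [_ Hx]].
  fold G0 G1 in E0, E1. destruct y as [y| |]; [|contradiction|].
  - apply boundary_condition_finite in Hx. rewrite E0, E1 in Hx. f_equal.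
    apply RtoC_inj. rewrite Hx. ring.
  - apply boundary_condition_infinite in Hx. rewrite E0 in Hx.
    apply RtoC_inj in Hx. lra. }
destruct h as [h| |]; [|contradiction|].
- apply K; [exact Hh'|]. intros u v. apply H.
- destruct h' as [h'| |]; [|contradiction|reflexivity].
  symmetry. apply K; [exact Hh|]. intros u v. apply H.
Qed.

End Positivity.

Close Scope C_scope.

Theorem corollary3 (A B : nat -> R)
    (HA : forall j : nat, (0 < A j)%R) (HB : forall j : nat, (0 < B j)%R)
    (Hnonneg : nonneg_operator (Tpremin A B))
    (Hdef : deficiency_indices A B 1 1) :
  in_l2 (polyP A B (RtoC 0)) /\ in_l2 (polyQ A B (RtoC 0)) /\
  boundary_triplet (Tmax A B) (Gamma0 A B) (Gamma1 A B) /\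
  (forall j : nat, polyP A B (RtoC 0) j <> RtoC 0) /\
  exists alpha : Rbar,
    is_lim_seq (ratioQP A B) alpha /\ Rbar_lt alpha p_infty /\
    (forall h : Rbar, Rbar_le h alpha -> nonneg_sa_extension A B (Text A B h)) /\
    (forall S : graph, nonneg_sa_extension A B S ->
       exists! h : Rbar, Rbar_le h alpha /\ same_graph S (Text A B h)) /\
    (forall u : cseq, dom (Text A B m_infty) u <->
       dom (Tmax A B) u /\ Gamma0 A B u = RtoC 0).
Proof.
split; [now apply polyP0_in_l2|].
split; [now apply polyQ0_in_l2|].
split; [now apply Gamma_boundary_triplet|].
split; [now apply polyP0_neq_0|].
destruct (ratioQP_limit A B HA HB Hnonneg) as [alpha [Hlim Hlt]].
exists alpha. split; [exact Hlim|split; [exact Hlt|split; [|split]]].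
- intros h Hh. now apply Text_nonneg_sa_extension with alpha.
- intros S HS.
  destruct (nonneg_sa_extension_Text A B HA HB Hnonneg Hdef alpha S Hlim HS) as [h [Hh E]].
  exists h. split; [now split|]. intros h' [Hh' E'].
  apply (Text_injective A B HB Hdef).
  + now apply Rbar_le_lt_trans with alpha.
  + now apply Rbar_le_lt_trans with alpha.
  + intros u v. split; intro K; [apply E', E, K|apply E, E', K].
- intro u. split.
  + intros [v [H0 H1]]. split; [now exists v|exact H1].
  + intros [[v H0] H1]. exists v. now split.
Qed.
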